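(* Let $B$ be a strictly generic quadratic $k$-algebra which is commutative (respectively non-commutative, respectively of Lie type). Then the Koszul dual $B^!$ is a generic $k$-algebra of Lie type (respectively a generic non-commutative algebra, respectively a generic commutative algebra).
   Context: $k$ is a field with prime field $k_0$. Algebras are graded, $A=\bigoplus_{i\ge0}A_i$, $A_0=k$, generated by the finite-dimensional space $A_1$; $A(z)=\sum_i\dim(A_i)z^i$. Quadratic algebras of type $(n,r)$. Commutative: $k[x_1,\ldots,x_n]/(f_1,\ldots,f_r)$ with $f_1,\ldots,f_r$ linearly independent quadratic forms. Non-commutative: $k\langle x_1,\ldots,x_n\rangle/(f_1,\ldots,f_r)$ with $f_1,\ldots,f_r$ linearly independent quadratic forms in the free associative algebra. Lie type: $k\langle x_1,\ldots,x_n\rangle/(f_1,\ldots,f_r)$ with $f_1,\ldots,f_r$ linearly independent elements of the form $f_i=\sum_{j}c_{i,j}x_j^2+\sum_{j<l}c_{i,j,l}(x_jx_l+x_lx_j)$, $c_{i,j},c_{i,j,l}\in k$. In each class, for $t=(n,r)$, let $A_t$ be the algebra of that class over the field $k_0(c)$ defined by $r$ relations whose coefficients (with respect to the commutative monomials of degree 2; the non-commutative monomials of degree 2; the elements $x_j^2$ and $x_jx_l+x_lx_j$, $j<l$, respectively) are distinct indeterminates, $c$ being the set of all these indeterminates. An algebra $A$ of type $(n,r)$ in one of the classes is generic (in that class) if $A(z)=A_t(z)$. It is strictly generic if it has a minimal presentation, namely $k[x_1,\ldots,x_n]/(f_1,\ldots,f_r)$ with $f_1,\ldots,f_r$ linearly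 independent quadratic forms in the commutative case, $k\langle x_1,\ldots,x_n\rangle/(f_1,\ldots,f_r)$ with $f_1,\ldots,f_r$ linearly independent quadratic forms in the free associative algebra in the non-commutative case, and $k\langle x_1,\ldots,x_n\rangle/(f_1,\ldots,f_r)$ with linearly independent $f_i=\sum_{j}c_{i,j}x_j^2+\sum_{j<l}c_{i,j,l}(x_jx_l+x_lx_j)$ in the Lie case, in which all the coefficients of the relations $f_1,\ldots,f_r$ (with respect to the commutative monomials of degree 2; the non-commutative monomials of degree 2; the elements $x_j^2$ and $x_jx_l+x_lx_j$, $j<l$, respectively) are algebraically independent over $k_0$. Koszul dual: a quadratic algebra (commutative ones being regarded as quotients of the free algebra, the commutators being included among the relations) can be written $A=T(V)/\langle U\rangle$ with $U\subseteq V\otimes V$; then $A^!=T(V^* )/\langle U^0\rangle$ with $U^0=\{f\in V^*\otimes V^*:\ f(U)=0\}$. The Koszul dual of a commutative quadratic algebra of type $(n,r)$ is of Lie type $(n,\binom{n+1}{2}-r)$ and conversely, and the Koszul dual of a non-commutative algebra of type $(n,r)$ has type $(n,n^2-r)$. *)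

(* Defs.v *)
From HB Require Import structures.
From mathcomp Require Import all_boot all_order all_algebra generic_quotient
  ring_quotient fraction boolp.
(* The notations of monalg clash with those of mpoly. *)
From mathcomp Require Import -(notations) monalg.
From mathcomp Require Import mpoly.

Set Implicit Arguments.
Unset Strict Implicit.
Unset Printing Implicit Defensive.

Import GRing.Theory.
Local Open Scope ring_scope.
Local Open Scope quotient_scope.

Inductive gen_ideal (R : nzRingType) (S : R -> Prop) : R -> Prop :=
| gen_ideal_in x : S x -> gen_ideal S x
| gen_ideal0 : gen_ideal S 0
| gen_idealD x y : gen_ideal S x -> gen_ideal S y -> gen_ideal S (x + y)
| gen_idealMl a x : gen_ideal S x -> gen_ideal S (a * x)
| gen_idealMr a x : gen_ideal S x -> gen_ideal S (x * a).

Definition ideal_pred (R : nzRingType) (S : R -> Prop) : {pred R} :=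
  fun x => `[< gen_ideal S x >].

Lemma gen_ideal_zmod_closed (R : nzRingType) (S : R -> Prop) :
  zmod_closed (ideal_pred S).
Proof.
split=> [|x y /asboolP hx /asboolP hy]; apply/asboolP; first exact: gen_ideal0.
by apply: gen_idealD => //; rewrite -mulN1r; apply: gen_idealMl.
Qed.

HB.instance Definition _ (R : nzRingType) (S : R -> Prop) :=
  GRing.isZmodClosed.Build R (ideal_pred S) (gen_ideal_zmod_closed S).

(* An algType is a nontrivial ring, hence the properness hypothesis hS. *)
Definition quot_alg (k : fieldType) (R : algType k) (S : R -> Prop)
    (hS : ~ gen_ideal S 1) : Type :=
  Quotient.quot (ideal_pred S : zmodClosed R).

Section QuotAlg.
Variables (k : fieldType) (R : algType k) (S : R -> Prop).
Variable hS : ~ gen_ideal S 1.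
Local Notation Q := (quot_alg hS).

HB.instance Definition _ := GRing.Zmodule.on Q.

Definition quot_proj (x : R) : Q :=
  \pi_(Quotient.quot (ideal_pred S : zmodClosed R)) x.
Definition quot_repr (x : Q) : R :=
  repr (x : Quotient.quot (ideal_pred S : zmodClosed R)).

Lemma quot_reprK : cancel quot_repr quot_proj.
Proof. exact: reprK. Qed.

Lemma quot_projP x y : quot_proj x = quot_proj y <-> gen_ideal S (x - y).
Proof.
split=> [/eqP|h]; first by rewrite -Quotient.idealrBE => /asboolP.
by apply/eqP; rewrite -Quotient.idealrBE; apply/asboolP.
Qed.

Lemma quot_repr_proj x : gen_ideal S (quot_repr (quot_proj x) - x).
Proof. by apply/quot_projP; rewrite quot_reprK. Qed.

Lemma quot_projD : {morph quot_proj : x y / x + y}.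
Proof. exact: raddfD. Qed.

Definition quot_one : Q := quot_proj 1.
Definition quot_mul (x y : Q) : Q := quot_proj (quot_repr x * quot_repr y).
Definition quot_scale (c : k) (x : Q) : Q := quot_proj (c *: quot_repr x).

Lemma quot_projM x y : quot_mul (quot_proj x) (quot_proj y) = quot_proj (x * y).
Proof.
apply/quot_projP; set x' := quot_repr _; set y' := quot_repr _.
have -> : x' * y' - x * y = (x' - x) * y' + x * (y' - y).
  by rewrite mulrBl mulrBr addrA subrK.
apply: gen_idealD; first exact/gen_idealMr/quot_repr_proj.
exact/gen_idealMl/quot_repr_proj.
Qed.

Lemma quot_projZ c x : quot_scale c (quot_proj x) = quot_proj (c *: x).
Proof.
apply/quot_projP; rewrite -scalerBr -mulr_algl.
exact/gen_idealMl/quot_repr_proj.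
Qed.

Lemma quot_mulA : associative quot_mul.
Proof.
move=> x y z; rewrite -[x]quot_reprK -[y]quot_reprK -[z]quot_reprK.
by rewrite !quot_projM mulrA.
Qed.

Lemma quot_mul1 : left_id quot_one quot_mul.
Proof. by move=> x; rewrite -[x]quot_reprK quot_projM mul1r. Qed.

Lemma quot_1mul : right_id quot_one quot_mul.
Proof. by move=> x; rewrite -[x]quot_reprK quot_projM mulr1. Qed.

Lemma quot_mulDl : left_distributive quot_mul +%R.
Proof.
move=> x y z; rewrite -[x]quot_reprK -[y]quot_reprK -[z]quot_reprK.
by rewrite -quot_projD !quot_projM -quot_projD mulrDl.
Qed.

Lemma quot_mulDr : right_distributive quot_mul +%R.
Proof.
move=> x y z; rewrite -[x]quot_reprK -[y]quot_reprK -[z]quot_reprK.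
by rewrite -quot_projD !quot_projM -quot_projD mulrDr.
Qed.

Lemma quot_one_neq0 : quot_one != 0.
Proof.
apply/eqP; have <- : quot_proj 0 = 0 by exact: raddf0.
by move=> /quot_projP; rewrite subr0.
Qed.

HB.instance Definition _ := GRing.Zmodule_isNzRing.Build Q
  quot_mulA quot_mul1 quot_1mul quot_mulDl quot_mulDr quot_one_neq0.

Lemma quot_scaleA a b x : quot_scale a (quot_scale b x) = quot_scale (a * b) x.
Proof. by rewrite -[x]quot_reprK !quot_projZ scalerA. Qed.

Lemma quot_scale1 : left_id 1 quot_scale.
Proof. by move=> x; rewrite -[x]quot_reprK quot_projZ scale1r. Qed.

Lemma quot_scaleDr : right_distributive quot_scale +%R.
Proof.
move=> c x y; rewrite -[x]quot_reprK -[y]quot_reprK.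
by rewrite -quot_projD !quot_projZ -quot_projD scalerDr.
Qed.

Lemma quot_scaleDl x : {morph quot_scale^~ x : a b / a + b}.
Proof.
by move=> a b; rewrite -[x]quot_reprK !quot_projZ -quot_projD scalerDl.
Qed.

HB.instance Definition _ := GRing.Zmodule_isLmodule.Build k Q
  quot_scaleA quot_scale1 quot_scaleDr quot_scaleDl.

Lemma quot_scaleAl (c : k) (x y : Q) : c *: (x * y) = c *: x * y.
Proof.
rewrite -[x]quot_reprK -[y]quot_reprK; set x' := quot_repr x.
set y' := quot_repr y.
change (quot_scale c (quot_mul (quot_proj x') (quot_proj y'))
  = quot_mul (quot_scale c (quot_proj x')) (quot_proj y')).
by rewrite quot_projM !quot_projZ quot_projM scalerAl.
Qed.

HB.instance Definition _ := GRing.Lmodule_isLalgebra.Build k Q quot_scaleAl.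

Lemma quot_scaleAr (c : k) (x y : Q) : c *: (x * y) = x * (c *: y).
Proof.
rewrite -[x]quot_reprK -[y]quot_reprK; set x' := quot_repr x.
set y' := quot_repr y.
change (quot_scale c (quot_mul (quot_proj x') (quot_proj y'))
  = quot_mul (quot_proj x') (quot_scale c (quot_proj y'))).
by rewrite quot_projM !quot_projZ quot_projM scalerAr.
Qed.

HB.instance Definition _ := GRing.Lalgebra_isAlgebra.Build k Q quot_scaleAr.

End QuotAlg.

(* The laws of a connected grading are not imposed: every graded algebra below
   is isomorphic, as a graded algebra, to a quotient of a polynomial algebra or
   of a free algebra by quadratic relations, where they hold. *)
Record gradedAlg (k : fieldType) := GradedAlg {
  galg_sort :> algType k;
  gcomp : nat -> galg_sort -> Prop
}.

Definition galg_iso (k : fieldType) (A B : gradedAlg k) : Prop :=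
  exists f : {lrmorphism A -> B},
    bijective f /\ forall d x, gcomp d x <-> gcomp d (f x).

Definition galg_quot (k : fieldType) (A : gradedAlg k) (S : A -> Prop)
    (hS : ~ gen_ideal S 1) : gradedAlg k :=
  @GradedAlg k (quot_alg hS)
    (fun d y => exists2 x : A, gcomp d x & y = quot_proj hS x).

Definition has_dim (k : fieldType) (V : lmodType k) (P : V -> Prop) (m : nat) :
    Prop :=
  exists b : 'I_m -> V,
    (forall c : 'I_m -> k, \sum_i c i *: b i = 0 -> forall i, c i = 0) /\
    (forall x, P x <-> exists c : 'I_m -> k, x = \sum_i c i *: b i).

(* The power series A(z) is given by its sequence h of coefficients. *)
Definition hilbert_series (k : fieldType) (A : gradedAlg k) (h : nat -> nat) :
    Prop :=
  forall d, has_dim (@gcomp k A d) (h d).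

Definition poly_galg (k : fieldType) (n : nat) : gradedAlg k :=
  @GradedAlg k {mpoly k[n]} (fun d p => p \is d.-homog).

Definition free_alg (k : fieldType) (n : nat) : Type :=
  malg (fmonom 'I_n) k.

Section FreeAlg.
Variables (k : fieldType) (n : nat).

HB.instance Definition _ := GRing.Lalgebra.on (free_alg k n).

Lemma free_scaleAr (c : k) (x y : free_alg k n) : c *: (x * y) = x * (c *: y).
Proof.
apply/malgP => m; rewrite monalg.mcoeffZ monalg.mcoeffMl mulr_sumr.
rewrite (monalg.mcoeffMlw (d1 := monalg.msupp x) (d2 := monalg.msupp y)) //;
  last exact: monalg.msuppZ_le.
apply: eq_bigr => k1 _; rewrite mulr_sumr; apply: eq_bigr => k2 _.
by rewrite monalg.mcoeffZ -mulrnAr mulrCA -mulrnAr -mulrnAr.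
Qed.

HB.instance Definition _ :=
  GRing.Lalgebra_isAlgebra.Build k (free_alg k n) free_scaleAr.

End FreeAlg.

Definition free_galg (k : fieldType) (n : nat) : gradedAlg k :=
  @GradedAlg k (free_alg k n)
    (fun d p => forall w : fmonom 'I_n,
       monalg.mcoeff w (p : malg (fmonom 'I_n) k) != 0 -> fdeg w = d).

Definition free_var (k : fieldType) (n : nat) (i : 'I_n) : free_alg k n :=
  mkmalgU (fmu i) 1.

(* The two-sided ideals considered below are proper: they lie in the kernel of
   the augmentation, that is, of the constant coefficient. *)
Lemma gen_ideal_proper (k : fieldType) (R : nzRingType)
    (eps : {rmorphism R -> k}) (S : R -> Prop) :
  (forall x, S x -> eps x = 0) -> ~ gen_ideal S 1.
Proof.
move=> hS h1; suff: eps 1 = 0 by rewrite rmorph1 => /eqP; rewrite oner_eq0.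
elim: h1 => [x /hS //||x y _ hx _ hy|a x _ hx|a x _ hx].
- exact: rmorph0.
- by rewrite rmorphD hx hy addr0.
- by rewrite rmorphM hx mulr0.
- by rewrite rmorphM hx mul0r.
Qed.

Definition free_aug (k : fieldType) (n : nat) : free_alg k n -> k :=
  monalg.mcoeff mone.

HB.instance Definition _ (k : fieldType) (n : nat) :=
  GRing.RMorphism.copy (@free_aug k n)
    (monalg.mcoeff mone : malg (fmonom 'I_n) k -> k).

Lemma free_augZ (k : fieldType) n c (x : free_alg k n) :
  free_aug (c *: x) = c * free_aug x.
Proof. exact: monalg.mcoeffZ. Qed.

Lemma free_aug_var (k : fieldType) n (i : 'I_n) :
  free_aug (free_var k i) = 0.
Proof.
rewrite /free_aug /free_var monalg.mcoeffU; case: eqP => // /(congr1 (@fdeg _)).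
by rewrite fdegU fdeg1.
Qed.

Variant quad_class := Commutative | NonCommutative | LieType.

Definition ambient (c : quad_class) (k : fieldType) (n : nat) : gradedAlg k :=
  if c is Commutative then poly_galg k n else free_galg k n.

Definition quad_index (c : quad_class) (n : nat) : finType :=
  if c is NonCommutative then ('I_n * 'I_n)%type
  else {p : 'I_n * 'I_n | (p.1 <= p.2)%N}.

Definition quad_basis (c : quad_class) (k : fieldType) (n : nat) :
    quad_index c n -> ambient c k n :=
  match c return quad_index c n -> ambient c k n with
  | Commutative => fun p => 'X_((val p).1) * 'X_((val p).2) : {mpoly k[n]}
  | NonCommutative => fun p => free_var k p.1 * free_var k p.2
  | LieType => fun p => let: (j, l) := val p in
      if j == l then free_var k j * free_var k j
      else free_var k j * free_var k l + free_var k l * free_var k j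
  end.
Arguments quad_basis : clear implicits.

Definition quad_form (c : quad_class) (k : fieldType) (n r : nat)
    (C : 'I_r -> quad_index c n -> k) (i : 'I_r) : ambient c k n :=
  \sum_(q : quad_index c n) C i q *: quad_basis c k n q.

Definition lin_indep (k : fieldType) (V : lmodType k) (r : nat)
    (f : 'I_r -> V) : Prop :=
  forall a : 'I_r -> k, \sum_i a i *: f i = 0 -> forall i, a i = 0.

Lemma quad_form_proper (c : quad_class) (k : fieldType) (n r : nat)
    (C : 'I_r -> quad_index c n -> k) :
  ~ gen_ideal (fun x => exists i, x = quad_form C i) 1.
Proof.
case: c C => C.
- apply: (@gen_ideal_proper k _ (mcoeff 0%MM : {mpoly k[n]} -> k)) => _ [i ->].
  rewrite /quad_form raddf_sum big1 // => q _.
  by rewrite /= linearZ /= rmorphM /= !mcoeffX mnm1_eq0 mul0r mulr0.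
- apply: (@gen_ideal_proper k _ (@free_aug k n)) => _ [i ->].
  rewrite /quad_form raddf_sum big1 // => q _.
  apply: etrans (free_augZ _ _) _.
  by rewrite /= rmorphM /= !free_aug_var mul0r mulr0.
- apply: (@gen_ideal_proper k _ (@free_aug k n)) => _ [i ->].
  rewrite /quad_form raddf_sum big1 // => q _.
  apply: etrans (free_augZ _ _) _ => /=.
  case: (val q) => j l; case: ifP => _; rewrite ?rmorphD rmorphM /=.
    by rewrite !free_aug_var !mul0r mulr0.
  by rewrite rmorphM /= !free_aug_var !mul0r addr0 mulr0.
Qed.

Definition quad_alg (c : quad_class) (k : fieldType) (n r : nat)
    (C : 'I_r -> quad_index c n -> k) : gradedAlg k :=
  galg_quot (@quad_form_proper c k n r C).

Definition has_type (c : quad_class) (k : fieldType) (n r : nat)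
    (A : gradedAlg k) : Prop :=
  exists C : 'I_r -> quad_index c n -> k,
    lin_indep (quad_form C) /\ galg_iso A (quad_alg C).

Definition prime_field (k0 : fieldType) : Prop :=
  forall S : {pred k0}, GRing.divring_closed S -> forall x, x \in S.

(* k0 is regarded as a subfield of k through iota. *)
Definition alg_indep (k0 k : fieldType) (iota : {rmorphism k0 -> k})
    (I : finType) (a : I -> k) : Prop :=
  forall p : {mpoly k0[#|I|]},
    mmap iota (fun j => a (enum_val j)) p = 0 -> p = 0.

Definition coeff_field (c : quad_class) (k0 : fieldType) (n r : nat) :
    fieldType :=
  {fraction {mpoly k0[#|{: 'I_r * quad_index c n}|]}}.

Definition indeterminate (c : quad_class) (k0 : fieldType) (n r : nat)
    (i : 'I_r) (q : quad_index c n) : coeff_field c k0 n r :=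
  tofrac ('X_(enum_rank (i, q))).

Definition indet_alg (c : quad_class) (k0 : fieldType) (n r : nat) :
    gradedAlg (coeff_field c k0 n r) :=
  quad_alg (@indeterminate c k0 n r).

Definition generic (c : quad_class) (k0 k : fieldType) (A : gradedAlg k) :
    Prop :=
  exists n r : nat, has_type c n r A /\
    exists h, hilbert_series A h /\ hilbert_series (indet_alg c k0 n r) h.

Definition strictly_generic (c : quad_class) (k0 k : fieldType)
    (iota : {rmorphism k0 -> k}) (B : gradedAlg k) : Prop :=
  exists (n r : nat) (C : 'I_r -> quad_index c n -> k),
    [/\ lin_indep (quad_form C), galg_iso B (quad_alg C) &
        alg_indep iota (fun x : 'I_r * quad_index c n => C x.1 x.2)].

(* With V = k^n, a tensor in V (x) V is the matrix of its coordinates in the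
   basis x_j (x) x_l; this is its image in the tensor algebra T(V). *)
Definition tensor2 (k : fieldType) (n : nat) (M : 'M[k]_n) : free_galg k n :=
  \sum_j \sum_l M j l *: (free_var k j * free_var k l).

Lemma tensor2_proper (k : fieldType) (n : nat) (U : 'M[k]_n -> Prop) :
  ~ gen_ideal (fun x => exists2 M, U M & x = tensor2 M) 1.
Proof.
apply: (@gen_ideal_proper k _ (@free_aug k n)) => _ [M _ ->].
rewrite /tensor2 raddf_sum big1 // => j _; rewrite raddf_sum big1 // => l _.
apply: etrans (free_augZ _ _) _.
by rewrite /= rmorphM /= !free_aug_var mul0r mulr0.
Qed.

Definition tensor_quot (k : fieldType) (n : nat) (U : 'M[k]_n -> Prop) :
    gradedAlg k :=
  galg_quot (@tensor2_proper k n U).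

(* V* is identified with k^n by the dual basis, so that an element of
   V* (x) V*, seen as a linear form on V (x) V, is the matrix of its values on
   the x_j (x) x_l. *)
Definition annihilator (k : fieldType) (n : nat) (U : {vspace 'M[k]_n})
    (N : 'M[k]_n) : Prop :=
  forall M, M \in U -> \sum_j \sum_l N j l * M j l = 0.

Definition is_koszul_dual (k : fieldType) (A D : gradedAlg k) : Prop :=
  exists (n : nat) (U : {vspace 'M[k]_n}),
    galg_iso A (tensor_quot (fun M => M \in U)) /\
    galg_iso D (tensor_quot (annihilator U)).

(* Main.v *)
(* The coefficient space of a quadratic algebra in degree d is the quotient of the
   space of tensors of degree d by the span of the words u f v, f a relation, so
   its dimension is a constant minus the rank of a matrix whose entries are
   integral linear forms in the coefficients of the relations.  Such a rank never
   goes up under specialization and is preserved by an injective one.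

   The relations of the dual of B are a basis C' of the orthogonal of the
   coefficient matrix C of B, hence specialize the generic matrix G of their
   size: the rank at C' is at most the rank at G.  Conversely let E be a basis of
   the orthogonal of G.  The rows of G are combinations of relations given by
   polynomial formulas in E (Cramer's rule); evaluating the same formulas at C,
   whose entries are algebraically independent, cannot lower the rank, and
   yields relations in the span of C'.  So the rank at G is at most the rank
   at C'. *)

From HB Require Import structures.
From mathcomp Require Import all_boot all_order all_algebra.
(* The notations of monalg clash with those of mpoly. *)
From mathcomp Require Import -(notations) finmap.
From mathcomp Require Import -(notations) monalg.
From mathcomp Require Import mpoly fraction boolp.
Require Import Defs.

Set Implicit Arguments.
Unset Strict Implicit.
Unset Printing Implicit Defensive.
Import GRing.Theory.
Local Open Scope ring_scope.

(** * Specialization of the rank *)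

(** The delicate bound is the one from below on the rank at [C']. Only the entries of [C] are known
    to be independent, and a basis of the orthogonal of [C] is neither canonical nor polynomial in
    [C]. Hence the use of generators of the orthogonal that may be redundant but involve no
    division; redundancy is harmless, since the rank of the matrix of words depends only on the span
    of the relations. The algebras to compare live over two different extensions of [k0] and meet
    only through polynomial rings over [k0], so the matrices are built over arbitrary commutative
    rings and commute with ring morphisms. One matrix serves the three classes because every algebra
    is presented as a quotient of the free algebra, the commutators being extra relations with
    constant coefficients. Another obstacle is that a Koszul dual comes from some presentation of
    [B], perhaps not the one with independent coefficients. A graded isomorphism of quadratic
    quotients is induced by an invertible linear substitution, and the contragredient substitution
    matches the annihilators. *)

Lemma mxrank_mxsub (F : fieldType) (m n p q : nat) (f : 'I_p -> 'I_m)
    (g : 'I_q -> 'I_n) (A : 'M[F]_(m, n)) :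
  (\rank (mxsub f g A) <= \rank A)%N.
Proof.
rewrite -[A in mxsub f g A]mulmx1 mxsub_mul -[A in rowsub f A]mul1mx.
rewrite -mul_rowsub_mx (leq_trans (mxrankM_maxl _ _)) //.
exact: mxrankM_maxr.
Qed.

Lemma unit_mxsub (F : fieldType) (m n : nat) (A : 'M[F]_(m, n)) :
  exists (f : 'I_(\rank A) -> 'I_m) (g : 'I_(\rank A) -> 'I_n),
    mxsub f g A \in unitmx.
Proof.
have fullB : row_full (rowsub (maxrankfun A) A)^T.
  by rewrite /row_full mxrank_tr; exact: maxrowsub_free.
have := mxrank_fullrowsub fullB; move: (fullrankfun fullB) => g rkB.
exists (maxrankfun A), g.
by rewrite mxsubcr -unitmx_tr trmx_mxsub -row_free_unit; apply/eqP.
Qed.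

(* A minor that survives under [psi] is nonzero, and so survives under the
   injective [phi]. *)
Lemma mxrank_specialize (R : comNzRingType) (K L : fieldType)
    (phi : {rmorphism R -> K}) (psi : {rmorphism R -> L}) (m n : nat)
    (A : 'M[R]_(m, n)) :
  injective phi -> (\rank (map_mx psi A) <= \rank (map_mx phi A))%N.
Proof.
move=> phi_inj; have [f [g]] := unit_mxsub (map_mx psi A).
rewrite -map_mxsub unitmxE det_map_mx unitfE => det_neq0.
apply: leq_trans (mxrank_mxsub f g (map_mx phi A)).
rewrite -map_mxsub mxrank_unit // unitmxE det_map_mx unitfE.
by apply: contraNneq det_neq0 => /eqP; rewrite raddf_eq0 // => /eqP->;
  rewrite rmorph0.
Qed.

(* Where [\det (Z *m C^T)] is invertible, this is a multiple of the projection
   onto the orthogonal of the rows of [C] along the rows of [Z]; it provides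
   generators of that orthogonal that are polynomial in [C]. *)
Definition orthgen_mx (R : comNzRingType) (r N : nat) (Z C : 'M[R]_(r, N)) :
    'M[R]_N :=
  (\det (Z *m C^T))%:M - C^T *m \adj (Z *m C^T) *m Z.

Lemma orthgen_mxK (R : comNzRingType) (r N : nat) (Z C : 'M[R]_(r, N)) :
  orthgen_mx Z C *m C^T = 0.
Proof.
rewrite mulmxBl mul_scalar_mx -!mulmxA mul_adj_mx mul_mx_scalar.
by rewrite subrr.
Qed.

(** On a vector orthogonal to the rows of [C], [orthgen_mx Z C] acts as multiplication by the
    determinant, which is invertible here. *)
Lemma orthgen_mx_full (F : fieldType) (r N m : nat) (Z C : 'M[F]_(r, N))
    (v : 'M_(m, N)) :
  Z *m C^T \in unitmx -> v *m C^T = 0 -> (v <= orthgen_mx Z C)%MS.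
Proof.
rewrite unitmxE unitfE => det_neq0 vC.
rewrite -(eqmx_scale v det_neq0); apply/submxP; exists v.
by rewrite mulmxBr mul_mx_scalar !mulmxA vC !mul0mx subr0.
Qed.

Lemma map_orthgen_mx (R S : comNzRingType) (phi : {rmorphism R ->
  S}) (r N : nat)
    (Z C : 'M[R]_(r, N)) :
  map_mx phi (orthgen_mx Z C) = orthgen_mx (map_mx phi Z) (map_mx phi C).
Proof.
rewrite /orthgen_mx !map_trmx -!map_mxM -map_mx_adj det_map_mx -!map_mxM.
by rewrite -map_scalar_mx -map_mxB.
Qed.

(** The matrix [rowsub f 1%:M] selects r independent columns of [C]. Its entries are 0 and 1, so it
    makes sense over every ring and is fixed by ring morphisms. *)
Lemma rowsub1_unit (F : fieldType) (r N : nat) (C : 'M[F]_(r, N)) :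
  row_free C ->
  exists f : 'I_r -> 'I_N, rowsub f 1%:M *m C^T \in unitmx.
Proof.
rewrite /row_free -mxrank_tr => fullC; exists (fullrankfun fullC).
by rewrite mul_rowsub_mx mul1mx -row_free_unit /row_free mxrank_fullrowsub.
Qed.

(** The number of rows is a variable [r], so that a basis can be given the size of a matrix fixed
    beforehand without casts. *)
Lemma row_free_base (F : fieldType) (m n r : nat) (A : 'M[F]_(m, n)) :
  \rank A = r -> exists2 B : 'M[F]_(r, n), row_free B & (B :=: A)%MS.
Proof.
by case: r /; exists (row_base A); [exact: row_base_free | exact: eq_row_base].
Qed.

(** * Words in the free algebra *)

Section Words.
Variables (k : fieldType) (n : nat).
Implicit Types (s t : seq 'I_n) (x y : free_alg k n).

Definition word s : free_alg k n := mkmalgU (FMonom s) 1.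

Definition wcoef s x : k := monalg.mcoeff (FMonom s) x.

Lemma wcoef_is_linear s : linear_for *%R (wcoef s).
Proof.
by move=> c x y; rewrite /wcoef monalg.mcoeffD; congr (_ + _);
  exact: monalg.mcoeffZ.
Qed.

HB.instance Definition _ s :=
  GRing.isLinear.Build k (free_alg k n) k _ (wcoef s) (wcoef_is_linear s).

Lemma wcoef0 s : wcoef s 0 = 0. Proof. exact: linear0. Qed.

Lemma wcoefD s x y : wcoef s (x + y) = wcoef s x + wcoef s y.
Proof. exact: linearD. Qed.

Lemma wcoefZ s c x : wcoef s (c *: x) = c * wcoef s x.
Proof. exact: linearZ. Qed.

Lemma scale_word c s : c *: word s = mkmalgU (FMonom s) c.
Proof.
apply/malgP => w; apply: etrans (monalg.mcoeffZ _ _ _) _.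
apply: etrans (congr1 _ (monalg.mcoeffU _ _ _)) _; rewrite mulr_natr.
exact/esym/monalg.mcoeffU.
Qed.

Lemma wcoef_sum s (I : Type) (r : seq I) (P : pred I) (x : I -> free_alg k n) :
  wcoef s (\sum_(i <- r | P i) x i) = \sum_(i <- r | P i) wcoef s (x i).
Proof. exact: linear_sum. Qed.

Lemma wcoef_word s t : wcoef s (word t) = (s == t)%:R.
Proof. by rewrite /wcoef monalg.mcoeffU1 fmP eq_sym. Qed.

Lemma wcoefP x y : (forall s, wcoef s x = wcoef s y) -> x = y.
Proof. by move=> eq_xy; apply/malgP => -[s]; apply: eq_xy. Qed.

Lemma free_algE x : x = \sum_(w <- monalg.msupp x) wcoef (fmonom_val w) x *:
  word (fmonom_val w).
Proof.
by rewrite {1}[x]monalgE; apply: eq_bigr => -[s] _; rewrite scale_word.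
Qed.

Lemma word_cat s t : word (s ++ t) = word s * word t.
Proof.
apply: esym; apply: etrans (fgmulUU _ _ _ _) _.
by rewrite mulr1; congr mkmalgU; rewrite /mmul /= fmmulE.
Qed.

Lemma word0 : word [::] = 1.
Proof. by congr mkmalgU; rewrite /mone /= fmoneE. Qed.

Lemma word1 i : word [:: i] = free_var k i.
Proof. by rewrite /free_var fmuE. Qed.

Lemma word_cons i s : word (i :: s) = free_var k i * word s.
Proof. by rewrite -word1 -word_cat. Qed.

Lemma word_rcons s i : word (rcons s i) = word s * free_var k i.
Proof. by rewrite -word1 -word_cat cats1. Qed.

Lemma free_alg_ind (P : free_alg k n -> Prop) :
  P 0 -> (forall x y, P x -> P y -> P (x + y)) ->
  (forall c s, P (c *: word s)) -> forall x, P x.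
Proof.
move=> P0 PD PZ x; rewrite [x]free_algE.
by elim/big_ind: _ => // w _; apply: PZ.
Qed.

Lemma free_gcompP d x :
  @gcomp k (free_galg k n) d x <-> forall s, wcoef s x != 0 -> size s = d.
Proof.
split=> [dx s|dx [s] /dx]; first by move=> /dx.
by [].
Qed.

Lemma wcoefMl i s x :
  wcoef s (free_var k i * x) =
  if s is j :: t then (if j == i then wcoef t x else 0) else 0.
Proof.
elim/free_alg_ind: x => [|x y IHx IHy|c t].
- by rewrite mulr0 !wcoef0; case: s => // j s; rewrite wcoef0 if_same.
- rewrite mulrDr wcoefD; apply: etrans (congr2 +%R IHx IHy) _.
  case: s {IHx IHy} => [|j s]; first by rewrite addr0.
  by case: (j == i); rewrite ?wcoefD // addr0.
- rewrite -scalerAr -word_cons wcoefZ wcoef_word; case: s => [|j s].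
    by rewrite mulr0.
  by rewrite eqseq_cons wcoefZ wcoef_word; case: eqP => _; rewrite ?mulr0.
Qed.

Lemma wcoefMr i s x :
  wcoef s (x * free_var k i) =
  if rev s is j :: t then (if j == i then wcoef (rev t) x else 0) else 0.
Proof.
elim/free_alg_ind: x => [|x y IHx IHy|c t].
- by rewrite mul0r !wcoef0; case: (rev s) => // j t; rewrite wcoef0 if_same.
- rewrite mulrDl wcoefD; apply: etrans (congr2 +%R IHx IHy) _.
  case: (rev s) => [|j t]; first by rewrite addr0.
  by case: (j == i); rewrite ?wcoefD // addr0.
- rewrite -scalerAl -word_rcons wcoefZ wcoef_word -(can_eq revK) rev_rcons.
  case: (rev s) => [|j u]; first by rewrite mulr0.
  rewrite eqseq_cons wcoefZ wcoef_word -(can_eq revK) revK.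
  by case: eqP => _; rewrite ?mulr0.
Qed.

Section MulClosed.
Variable P : free_alg k n -> Prop.
Hypotheses (P0 : P 0) (PD : forall x y, P x -> P y -> P (x + y)).
Hypothesis PZ : forall c x, P x -> P (c *: x).

(** Reduces stability under multiplication by any element to the case of a variable, by linearity
    and induction on words. *)
Lemma free_mul_closedl :
  (forall i x, P x -> P (free_var k i * x)) -> forall a x, P x -> P (a * x).
Proof.
move=> PM a x Px; elim/free_alg_ind: a => [|a b|c s].
- by rewrite mul0r.
- by rewrite mulrDl; apply: PD.
rewrite -scalerAl; apply: PZ; elim: s => [|i s IHs].
  by rewrite word0 mul1r.
by rewrite word_cons -mulrA; apply: PM.
Qed.

Lemma free_mul_closedr :
  (forall i x, P x -> P (x * free_var k i)) -> forall a x, P x -> P (x * a).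
Proof.
move=> PM a x Px; elim/free_alg_ind: a => [|a b|c s].
- by rewrite mulr0.
- by rewrite mulrDr; apply: PD.
rewrite -scalerAr; apply: PZ; elim/last_ind: s => [|s i IHs].
  by rewrite word0 mulr1.
by rewrite word_rcons mulrA; apply: PM.
Qed.

End MulClosed.

Lemma free_gcomp_word s : @gcomp k (free_galg k n) (size s) (word s).
Proof.
by apply/free_gcompP => t; rewrite wcoef_word; case: (t =P s) => [->|];
  rewrite ?eqxx.
Qed.

Lemma free_gcomp_ind d (P : free_alg k n -> Prop) :
  P 0 -> (forall x y, P x -> P y -> P (x + y)) ->
  (forall c s, size s = d -> P (c *: word s)) ->
  forall x, @gcomp k (free_galg k n) d x -> P x.
Proof.
move=> P0 PD PZ x /free_gcompP dx; rewrite [x]free_algE.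
elim/big_ind: _ => // w _; case: (eqVneq (wcoef (fmonom_val w) x) 0) => [->|].
  by rewrite scale0r.
by move=> /dx; apply: PZ.
Qed.

Lemma free_gcomp1 x :
  @gcomp k (free_galg k n) 1 x -> x = \sum_i wcoef [:: i] x *: free_var k i.
Proof.
move=> /free_gcompP dx; apply: wcoefP => s; rewrite wcoef_sum.
under eq_bigr do rewrite wcoefZ -word1 wcoef_word.
have [|/dx] := eqVneq (wcoef s x) 0; last first.
  case: s => [//|i [|//]] _; rewrite (bigD1 i) //= eqxx mulr1 big1 ?addr0 //.
  by move=> j ne_ji; rewrite eqseq_cons andbT eq_sym (negPf ne_ji) mulr0.
move=> x0; rewrite x0 big1 // => i _.
by case: eqP x0 => [->|_ _]; rewrite ?mulr0 // => ->; rewrite mul0r.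
Qed.

End Words.

Section FreeEval.
Variables (k : fieldType) (n : nat) (A : algType k) (h : 'I_n -> A).

Definition free_eval (x : free_alg k n) : A :=
  monalg.mmap (in_alg A) (fun w : fmonom 'I_n =>
    \prod_(i <- fmonom_val w) h i) x.

Lemma free_evalD x y : free_eval (x + y) = free_eval x + free_eval y.
Proof. exact: (@monalg.mmapD _ _ _ (in_alg A)). Qed.

Lemma free_eval0 : free_eval 0 = 0.
Proof. exact: (@monalg.mmap0 _ _ _ (in_alg A)). Qed.

Lemma free_eval_scale_word c s :
  free_eval (c *: word k s) = c *: \prod_(i <- s) h i.
Proof.
rewrite scale_word; apply: etrans (@monalg.mmapU _ _ _ (in_alg A) _ _ _) _.
by rewrite /= mulr_algl.
Qed.

Lemma free_evalZ c x : free_eval (c *: x) = c *: free_eval x.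
Proof.
elim/free_alg_ind: x => [|x y IHx IHy|d s].
- by rewrite scaler0 free_eval0 scaler0.
- by rewrite scalerDr !free_evalD scalerDr; apply: (congr2 +%R IHx IHy).
- rewrite scalerA; apply: etrans (free_eval_scale_word _ _) _.
  by rewrite -scalerA; congr (_ *: _); apply/esym/free_eval_scale_word.
Qed.

Lemma free_eval_is_linear : linear free_eval.
Proof. by move=> c x y; rewrite free_evalD free_evalZ. Qed.

HB.instance Definition _ :=
  GRing.isLinear.Build k (free_alg k n) A _ free_eval free_eval_is_linear.

Lemma free_eval_word s : free_eval (word k s) = \prod_(i <- s) h i.
Proof. by rewrite -[word k s]scale1r free_eval_scale_word scale1r. Qed.

Lemma free_eval_is_monoid_morphism : monoid_morphism free_eval.
Proof.
split=> [|x y]; first by rewrite -(word0 k n) free_eval_word big_nil.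
elim/free_alg_ind: x => [|x x' IHx IHx'|c s].
- by rewrite mul0r free_eval0 mul0r.
- rewrite mulrDl !free_evalD mulrDl; exact: (congr2 +%R IHx IHx').
elim/free_alg_ind: y => [|y y' IHy IHy'|d t].
- by rewrite mulr0 free_eval0 mulr0.
- rewrite mulrDr !free_evalD mulrDr; exact: (congr2 +%R IHy IHy').
rewrite -scalerAl -scalerAr -word_cat scalerA.
apply: etrans (free_eval_scale_word _ _) _; rewrite big_cat /=; apply: esym.
apply: etrans (congr2 *%R (free_eval_scale_word _ _) (free_eval_scale_word _ _))
  _.
by rewrite -scalerAl -scalerAr scalerA.
Qed.

HB.instance Definition _ :=
  GRing.isMonoidMorphism.Build (free_alg k n) A free_eval
    free_eval_is_monoid_morphism.

Lemma free_eval_var i : free_eval (free_var k i) = h i.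
Proof. by rewrite -word1 free_eval_word big_seq1. Qed.

End FreeEval.

Lemma eq_free_lrmorphism (k : fieldType) (n : nat) (A : algType k)
    (f g : {lrmorphism free_alg k n -> A}) :
  (forall i, f (free_var k i) = g (free_var k i)) -> f =1 g.
Proof.
move=> eq_fg; elim/free_alg_ind => [|x y eq_x eq_y|c s].
- by rewrite !linear0.
- by rewrite !linearD; apply: (congr2 +%R eq_x eq_y).
rewrite !linearZ /=; congr (_ *: _); elim: s => [|i s IHs].
  by rewrite word0 !rmorph1.
rewrite word_cons; apply: etrans (rmorphM f _ _) _.
by apply: etrans (congr2 *%R (eq_fg i) IHs) _; rewrite rmorphM.
Qed.

(** * Ideals of quadratic relations and Hilbert series *)

(** A basis of a complement of the kernel of [f] is sent to a basis of its image. *)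
Lemma has_dim_image (k : fieldType) (V : lmodType k) (N m : nat)
    (f : {linear 'rV[k]_N -> V}) (A : 'M[k]_(m, N)) (P : V -> Prop) :
  (forall v, f v = 0 <-> (v <= A)%MS) ->
    (forall y, P y <-> exists v, y = f v) ->
  has_dim P (N - \rank A).
Proof.
move=> fA Pf; have [B freeB defB] := row_free_base (mxrank_compl A).
have fsum (c : 'I_(N - \rank A) -> k) :
    \sum_i c i *: f (row i B) = f ((\row_i c i) *m B).
  rewrite mulmx_sum_row linear_sum; apply: eq_bigr => i _.
  by rewrite linearZ mxE.
exists (fun i => f (row i B)); split=> [c|y]; last first.
  rewrite Pf; split=> [[v ->]|[c ->]]; last by rewrite fsum;
    exists ((\row_i c i) *m B).
  have /sub_addsmxP[[v1 v2] /= def_v] : (v <= A + A^C)%MS.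
    by rewrite submx_full ?addsmx_compl_full.
  have /submxP[w def_w] : (v2 *m A^C <= B)%MS by rewrite defB submxMl.
  exists (fun i => w 0 i); rewrite fsum def_v linearD.
  have -> : f (v1 *m A) = 0 by apply/fA; rewrite submxMl.
  by rewrite add0r def_w; congr (f (_ *m _)); apply/rowP => i; rewrite mxE.
rewrite fsum => /fA cA i.
have : ((\row_i c i) *m B <= A :&: A^C)%MS by rewrite sub_capmx cA -defB
  submxMl.
rewrite capmx_compl submx0 mulmx_free_eq0 // => /eqP/rowP/(_ i).
by rewrite !mxE.
Qed.

Section QuotProj.
Variables (k : fieldType) (R : algType k) (S : R -> Prop).
Variable hS : ~ gen_ideal S 1.

Lemma quot_proj_is_linear : linear (quot_proj hS).
Proof. by move=> c x y; rewrite quot_projD -quot_projZ. Qed.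

Lemma quot_proj_is_monoid_morphism : monoid_morphism (quot_proj hS).
Proof. by split=> // x y; rewrite -quot_projM. Qed.

HB.instance Definition _ :=
  GRing.isLinear.Build k R (quot_alg hS) _ (quot_proj hS) quot_proj_is_linear.
HB.instance Definition _ :=
  GRing.isMonoidMorphism.Build R (quot_alg hS) (quot_proj hS)
    quot_proj_is_monoid_morphism.

Lemma quot_proj_eq0 x : quot_proj hS x = 0 <-> gen_ideal S x.
Proof.
rewrite -[x in gen_ideal S x]subr0.
have <- : quot_proj hS 0 = 0 by exact: linear0.
exact: quot_projP.
Qed.

End QuotProj.

Inductive lin_span (k : fieldType) (V : lmodType k) (S : V -> Prop) : V ->
  Prop :=
| lin_span_in x : S x -> lin_span S x
| lin_span0 : lin_span S 0
| lin_spanD x y : lin_span S x -> lin_span S y -> lin_span S (x + y)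
| lin_spanZ c x : lin_span S x -> lin_span S (c *: x).

Lemma gen_idealZ (k : fieldType) (R : algType k) (S : R -> Prop) c x :
  gen_ideal S x -> gen_ideal S (c *: x).
Proof. by move=> Sx; rewrite -mulr_algl; apply: gen_idealMl. Qed.

Lemma gen_ideal_sum (R : nzRingType) (S : R -> Prop) (I : Type) (s : seq I)
    (P : pred I) (x : I -> R) :
  (forall i, P i -> gen_ideal S (x i)) -> gen_ideal S (\sum_(i <- s | P i) x i).
Proof.
by move=> Sx; elim/big_ind: _ => // [|y z];
  [exact: gen_ideal0 | exact: gen_idealD].
Qed.

(** * The ideal of a family of quadratic tensors, degree by degree *)

Section TensorIdeal.
Variables (k : fieldType) (n : nat).
Implicit Types (s t u v : seq 'I_n) (x : free_alg k n) (M : 'M[k]_n).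

Definition tens M : free_alg k n := tensor2 M.

Lemma tensE M : tens M = \sum_j \sum_l M j l *: word k [:: j; l].
Proof.
by apply: eq_bigr => j _; apply: eq_bigr => l _; rewrite !word_cons word0 mulr1.
Qed.

Lemma tens_is_linear : linear tens.
Proof.
move=> c M N; rewrite !tensE scaler_sumr -big_split; apply: eq_bigr => j _ /=.
rewrite scaler_sumr -big_split; apply: eq_bigr => l _ /=.
by rewrite !mxE scalerDl scalerA.
Qed.

HB.instance Definition _ :=
  GRing.isLinear.Build k 'M[k]_n (free_alg k n) _ tens tens_is_linear.

End TensorIdeal.

(* The coefficient of the word [w] in [u * M * v], where the tensor [M] has
   degree two. *)
Definition sandwich (R : pzRingType) (n : nat) (M : 'M[R]_n) (u v w : seq 'I_n)
  : R :=
  if drop (size u) w is [:: j, l & t] then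
    if (take (size u) w == u) && (t == v) then M j l else 0
  else 0.

(* A pair of words [u], [v] of total length [d - 2] is encoded by [u ++ v] and the
   length of [u]; there is none if [d < 2]. *)
Definition sandwich_index (I : finType) (n d : nat) : finType :=
  ('I_d.-1 * d.-2.-tuple 'I_n * I)%type.

Definition sandwich_mx (R : pzRingType) (I : finType) (n : nat)
    (F : I -> 'M[R]_n) (d : nat) :
    'M[R]_(#|sandwich_index I n d|, #|{: d.-tuple 'I_n}|) :=
  \matrix_(a, b)
    let x : 'I_d.-1 * d.-2.-tuple 'I_n * I := enum_val a in
    let w : d.-tuple 'I_n := enum_val b in
    sandwich (F x.2) (take x.1.1 x.1.2) (drop x.1.1 x.1.2) w.

Lemma eq_sandwich_mx (R : pzRingType) (I : finType) (n : nat)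
    (F G : I -> 'M[R]_n) (d : nat) : F =1 G ->
      sandwich_mx F d = sandwich_mx G d.
Proof. by move=> eq_FG; apply/matrixP => a b; rewrite !mxE /= eq_FG. Qed.

Lemma map_sandwich_mx (R S : nzRingType) (phi : {rmorphism R -> S})
    (I : finType) (n : nat) (F : I -> 'M[R]_n) (d : nat) :
  map_mx phi (sandwich_mx F d) = sandwich_mx (fun i => map_mx phi (F i)) d.
Proof.
apply/matrixP => a b; rewrite !mxE /sandwich.
case: (drop _ _) => [|j [|l t]]; rewrite ?rmorph0 //.
by case: ifP; rewrite ?rmorph0 // mxE.
Qed.

Lemma wcoef_sandwich (k : fieldType) (n : nat) (M : 'M[k]_n) (u v w : seq 'I_n)
  :
  wcoef w (word k u * tens M * word k v) = sandwich M u v w.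
Proof.
have -> : word k u * tens M * word k v
    = \sum_j \sum_l M j l *: word k (u ++ [:: j, l & v]).
  rewrite tensE mulr_sumr mulr_suml; apply: eq_bigr => j _.
  rewrite mulr_sumr mulr_suml; apply: eq_bigr => l _.
  by rewrite -scalerAr -scalerAl -!word_cat -catA.
rewrite wcoef_sum /sandwich.
under eq_bigr => j _ do rewrite wcoef_sum.
under eq_bigr => j _ do under eq_bigr => l _ do rewrite wcoefZ wcoef_word.
have eq_w t : (w == u ++ t) = (take (size u) w == u) && (drop (size u) w == t).
  apply/eqP/andP => [->|[/eqP def_u /eqP <-]].
    by rewrite take_size_cat ?drop_size_cat.
  by rewrite -{1}def_u cat_take_drop.
under eq_bigr => j _ do under eq_bigr => l _ do rewrite eq_w.
case: (drop _ _) => [|a [|b t]].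
- by rewrite big1 // => j _; rewrite big1 // => l _; rewrite andbF mulr0.
- by rewrite big1 // => j _; rewrite big1 // => l _;
    rewrite !eqseq_cons !andbF mulr0.
rewrite (bigD1 a) //= (bigD1 b) //= !eqseq_cons !eqxx /= !big1 ?addr0.
- by case: ifP; rewrite ?mulr1 ?mulr0.
- by move=> j ne_ja; rewrite big1 // => l _; rewrite !eqseq_cons [a == j]eq_sym
    (negPf ne_ja) andbF mulr0.
- by move=> l ne_lb; rewrite !eqseq_cons [b == l]eq_sym (negPf ne_lb) !andbF
    mulr0.
Qed.

Section SandwichIdeal.
Variables (k : fieldType) (n : nat) (I : finType) (F : I -> 'M[k]_n).
Implicit Types (x : free_alg k n).

Definition fam_rel x := exists i, x = tens (F i).

Definition sandwich_elt x := exists u v i, x = word k u * tens (F i) * word k v.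

(** The span of the words u f v is stable under multiplication by a variable on either side, hence
    is already an ideal. *)
Lemma fam_ideal_span x : gen_ideal fam_rel x -> lin_span sandwich_elt x.
Proof.
elim=> {x} [x [i ->]||x y _ Sx _ Sy|a x _|a x _].
- by apply: lin_span_in; exists [::], [::], i; rewrite word0 mul1r mulr1.
- exact: lin_span0.
- exact: lin_spanD.
- apply: free_mul_closedl; [exact: lin_span0|exact: lin_spanD|exact:
    lin_spanZ|].
  move=> j y; elim=> {y} [y [u [v [i ->]]]||y z _ Sy _ Sz|c y _ Sy].
  + apply: lin_span_in; exists (j :: u), v, i.
    by rewrite word_cons !mulrA.
  + by rewrite mulr0; apply: lin_span0.
  + by rewrite mulrDr; apply: lin_spanD.
  + by rewrite -scalerAr; apply: lin_spanZ.
- apply: free_mul_closedr; [exact: lin_span0|exact: lin_spanD|exact: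
    lin_spanZ|].
  move=> j y; elim=> {y} [y [u [v [i ->]]]||y z _ Sy _ Sz|c y _ Sy].
  + apply: lin_span_in; exists u, (rcons v j), i.
    by rewrite word_rcons; apply/esym/mulrA.
  + by rewrite mul0r; apply: lin_span0.
  + by rewrite mulrDl; apply: lin_spanD.
  + by rewrite -scalerAl; apply: lin_spanZ.
Qed.

Local Notation rV d := 'rV[k]_#|{: d.-tuple 'I_n}|.

Definition word_row d x : rV d :=
  \row_b wcoef (enum_val b : d.-tuple 'I_n) x.

Definition row_word d (v : rV d) : free_alg k n :=
  \sum_b v 0 b *: word k (enum_val b : d.-tuple 'I_n).

Lemma word_row_is_linear d : linear (word_row d).
Proof. by move=> c x y; apply/rowP => b; rewrite !mxE linearP. Qed.

HB.instance Definition _ d :=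
  GRing.isLinear.Build k (free_alg k n) _ _ (word_row d) (word_row_is_linear d).

Lemma row_word_is_linear d : linear (@row_word d).
Proof.
move=> c v w; rewrite /row_word scaler_sumr -big_split.
by apply: eq_bigr => b _; rewrite !mxE scalerDl scalerA.
Qed.

HB.instance Definition _ d :=
  GRing.isLinear.Build k _ (free_alg k n) _ (@row_word d) (@row_word_is_linear
    d).

Lemma row_wordK d : cancel (@row_word d) (word_row d).
Proof.
move=> v; apply/rowP => b; rewrite mxE wcoef_sum.
under eq_bigr => c _ do
  rewrite wcoefZ wcoef_word val_eqE (inj_eq enum_val_inj) eq_sym.
rewrite (bigD1 b) //= eqxx mulr1 big1 ?addr0 // => c ne_cb.
by rewrite (negPf ne_cb) mulr0.
Qed.

Lemma row_word_gcomp d (v : rV d) : @gcomp k (free_galg k n) d (row_word v).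
Proof.
apply/free_gcompP => s; apply: contraNeq => ne_sd; rewrite wcoef_sum big1 //.
move=> b _; rewrite wcoefZ wcoef_word.
by case: (s =P _) ne_sd => [->|_ _]; rewrite ?size_tuple ?eqxx ?mulr0.
Qed.

Lemma word_rowK d x : @gcomp k (free_galg k n) d x ->
  row_word (word_row d x) = x.
Proof.
move=> dx; apply: wcoefP => s.
have [ds|ds] := eqVneq (size s) d; last first.
  have /free_gcompP dr := @row_word_gcomp d (word_row d x).
  move/free_gcompP: dx => dx.
  have [->|/dx] := eqVneq (wcoef s x) 0; last by move/eqP: ds.
  by have [->|/dr] := eqVneq (wcoef s (row_word (word_row d x))) 0;
    last by move/eqP: ds.
have /rowP/(_ (enum_rank (tcast ds (in_tuple s)))) := row_wordK (word_row d x).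
by rewrite !mxE enum_rankK val_tcast.
Qed.

Lemma row_sandwich_mx d (a : 'I_#|sandwich_index I n d|) :
  let x : 'I_d.-1 * d.-2.-tuple 'I_n * I := enum_val a in
  row a (sandwich_mx F d) =
  word_row d (word k (take x.1.1 x.1.2) * tens (F x.2) * word k (drop x.1.1
    x.1.2)).
Proof. by apply/rowP => b; rewrite !mxE wcoef_sandwich. Qed.

(** No homogeneity of [x] is assumed: [word_row d] keeps only the component of degree d, and a
    product u f v of another degree is sent to 0. *)
Lemma sandwich_mx_word_row d x :
  gen_ideal fam_rel x -> (word_row d x <= sandwich_mx F d)%MS.
Proof.
move=> /fam_ideal_span; elim=> {x} [x [u [v [i ->]]]||x y _ Sx _ Sy|c x _ Sx].
- have [size_uv|size_uv] := eqVneq (size u + size v).+2 d; last first.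
    suff -> : word_row d (word k u * tens (F i) * word k v) = 0 by exact:
      sub0mx.
    apply/rowP => b; rewrite !mxE wcoef_sandwich /sandwich.
    have := size_tuple (enum_val b : d.-tuple 'I_n).
    rewrite -{1}(cat_take_drop (size u) (enum_val b)) size_cat.
    case: (drop _ _) => [|j [|l t]] //= size_b;
      case: ifP => // /andP[/eqP def_u /eqP def_v].
    by case/eqP: size_uv; rewrite -size_b def_u def_v !addnS.
  (* Once d is literally [(size u + size v).+2], its predecessors compute and the pair u, v can be
     typed as a row index. *)
  case: d / size_uv.
  have lt_u : (size u < (size u + size v).+1)%N by rewrite ltnS leq_addr.
  have sz_uv : size (u ++ v) == (size u + size v)%N by rewrite size_cat.
  pose a : sandwich_index I n (size u + size v).+2 := (Ordinal lt_u,
    Tuple sz_uv, i).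
  have := row_sandwich_mx (enum_rank a); rewrite enum_rankK /=.
  by rewrite take_size_cat // drop_size_cat // => <-; apply: row_sub.
- by rewrite linear0 sub0mx.
- by rewrite linearD addmx_sub.
- by rewrite linearZ scalemx_sub.
Qed.

Lemma sandwich_mx_ideal d (v : rV d) :
  (v <= sandwich_mx F d)%MS -> gen_ideal fam_rel (row_word v).
Proof.
case/submxP => c ->; rewrite mulmx_sum_row linear_sum.
apply: gen_ideal_sum => a _; rewrite linearZ /=; apply: gen_idealZ.
rewrite row_sandwich_mx; set x : 'I_d.-1 * d.-2.-tuple 'I_n * I := enum_val a.
rewrite word_rowK; last first.
  apply/free_gcompP => s; rewrite wcoef_sandwich /sandwich -[in size
    s](cat_take_drop (size (take x.1.1 x.1.2)) s).
  case: (drop _ s) => [|j [|l t]]; rewrite ?eqxx //.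
  case: ifP; rewrite ?eqxx // => /andP[/eqP -> /eqP ->] _.
  rewrite size_cat /= !addnS -size_cat cat_take_drop size_tuple.
  (* A row index contains an element of ['I_d.-1], which is empty for d < 2, the only case where
     adding 2 to [d.-2] does not give back d. *)
  by move: (ltn_ord x.1.1); move: (nat_of_ord _) => p; case: (d) => [|[|d']].
apply/gen_idealMr/gen_idealMl/gen_ideal_in; by exists x.2.
Qed.

Lemma fam_idealP d (v : rV d) : gen_ideal fam_rel (row_word v) <-> (v <=
  sandwich_mx F d)%MS.
Proof.
split; last exact: sandwich_mx_ideal.
by move=> /(sandwich_mx_word_row d); rewrite row_wordK.
Qed.

End SandwichIdeal.

Definition fam_alg (k : fieldType) (n : nat) (I : finType) (F : I -> 'M[k]_n) :
    gradedAlg k :=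
  tensor_quot (fun M => exists i, M = F i).

Lemma gen_ideal_sub (R : nzRingType) (S T : R -> Prop) :
  (forall x, S x -> gen_ideal T x) -> forall x, gen_ideal S x -> gen_ideal T x.
Proof.
move=> ST x; elim=> {x} [x /ST //||x y _ Tx _ Ty|a x _ Tx|a x _ Tx].
- exact: gen_ideal0.
- exact: gen_idealD.
- exact: gen_idealMl.
- exact: gen_idealMr.
Qed.

Lemma hilbert_fam_alg (k : fieldType) (n : nat) (I : finType) (F : I ->
  'M[k]_n) :
  hilbert_series (fam_alg F)
    (fun d => (#|{: d.-tuple 'I_n}| - \rank (sandwich_mx F d))%N).
Proof.
move=> d; pose hS := @tensor2_proper k n (fun M => exists i, M = F i).
apply: (@has_dim_image k _ _ _ (quot_proj hS \o @row_word k n d)) => [v|y].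
  rewrite /= quot_proj_eq0 -fam_idealP; split; apply: gen_ideal_sub => x.
    by case=> M [i ->] ->; apply: gen_ideal_in; exists i.
  by case=> i ->; apply: gen_ideal_in; exists (F i) => //; exists i.
split=> [[x dx ->]|[v ->]]; last by exists (row_word v) => //;
  apply: row_word_gcomp.
by exists (word_row d x); rewrite /= word_rowK.
Qed.

(** * Isomorphisms of graded quotients *)

Lemma galg_iso_trans (k : fieldType) (A B C : gradedAlg k) :
  galg_iso A B -> galg_iso B C -> galg_iso A C.
Proof.
move=> [f [f_bij f_gr]] [g [g_bij g_gr]].
exists (g \o f : {lrmorphism A -> C}); split; first exact: bij_comp.
by move=> d x; rewrite f_gr g_gr.
Qed.

Lemma lrmorphism_inv (k : fieldType) (A B : algType k) (f : {lrmorphism A -> B})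
    (g : B -> A) :
  cancel f g -> cancel g f -> exists g' : {lrmorphism B -> A}, g' =1 g.
Proof.
move=> fK gK.
pose g_lin := GRing.isLinear.Build k B A _ g (can2_linear fK gK).
pose g_mul := GRing.isMonoidMorphism.Build B A g (can2_monoid_morphism fK gK).
pose g' : {lrmorphism B -> A} := HB.pack g g_lin g_mul.
by exists g'.
Qed.

Lemma galg_iso_sym (k : fieldType) (A B : gradedAlg k) :
  galg_iso A B -> galg_iso B A.
Proof.
move=> [f [[g fK gK] f_gr]]; have [g' eq_g] := lrmorphism_inv fK gK.
exists g'; split; first by exists f => x; rewrite eq_g ?fK ?gK.
by move=> d x; rewrite f_gr eq_g gK.
Qed.

Lemma hilbert_series_iso (k : fieldType) (A B : gradedAlg k) (h : nat -> nat) :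
  galg_iso A B -> hilbert_series A h -> hilbert_series B h.
Proof.
move=> [f [[g fK gK] f_gr]] hA d; have [b [b_free b_span]] := hA d.
have fsum (c : 'I_(h d) -> k) : \sum_i c i *: f (b i) = f (\sum_i c i *: b i).
  by rewrite linear_sum; apply: eq_bigr => i _; rewrite linearZ.
exists (fun i => f (b i)); split=> [c|y].
  rewrite fsum => fc0; apply: b_free; apply: (can_inj fK).
  by rewrite linear0.
rewrite -[y]gK -f_gr b_span; split=> -[c def_y]; exists c.
  by rewrite fsum def_y.
by rewrite -[LHS]fK def_y fsum fK.
Qed.

Lemma gen_ideal_ker (R R' : nzRingType) (f : {rmorphism R -> R'}) (S : R ->
  Prop) :
  (forall x, S x -> f x = 0) -> forall x, gen_ideal S x -> f x = 0.
Proof.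
move=> fS x; elim=> {x} [x /fS //||x y _ fx _ fy|a x _ fx|a x _ fx].
- exact: rmorph0.
- by rewrite rmorphD fx fy addr0.
- by rewrite rmorphM fx mulr0.
- by rewrite rmorphM fx mul0r.
Qed.

Lemma quot_lift (k : fieldType) (R R' : algType k) (S : R -> Prop)
    (hS : ~ gen_ideal S 1) (f : {lrmorphism R -> R'}) :
  (forall x, S x -> f x = 0) ->
  exists g : {lrmorphism quot_alg hS -> R'}, forall x, g (quot_proj hS x) = f x.
Proof.
move=> fS; have fI := gen_ideal_ker fS.
pose g x := f (quot_repr (hS := hS) x).
have gE x : g (quot_proj hS x) = f x.
  by apply/eqP; rewrite -subr_eq0 -linearB; apply/eqP/fI/quot_repr_proj.
have g_linear : linear g.
  move=> c x y; rewrite -[x]quot_reprK -[y]quot_reprK.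
  apply: etrans (congr1 g (esym (linearP (quot_proj hS) c _ _))) _.
  by rewrite !gE linearP.
have g_mul : monoid_morphism g.
  split=> [|x y]; first by rewrite gE rmorph1.
  rewrite -[x]quot_reprK -[y]quot_reprK.
  apply: etrans (congr1 g (esym (rmorphM (quot_proj hS) _ _))) _.
  by rewrite !gE rmorphM.
pose gL := GRing.isLinear.Build k (quot_alg hS) R' _ g g_linear.
pose gM := GRing.isMonoidMorphism.Build (quot_alg hS) R' g g_mul.
pose g' : {lrmorphism quot_alg hS -> R'} := HB.pack g gL gM.
by exists g'.
Qed.

(** Only surjectivity of [f] is required, so that this applies to abelianization; the equivalence of
    ideals puts the kernel of [f] inside the ideal of [S]. The lifting of homogeneous elements makes
    the inverse respect degrees. *)
Lemma galg_quot_iso (k : fieldType) (A A' : gradedAlg k)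
    (S : A -> Prop) (S' : A' -> Prop)
    (hS : ~ gen_ideal S 1) (hS' : ~ gen_ideal S' 1) (f : {lrmorphism A -> A'}) :
  (forall x, gen_ideal S x <-> gen_ideal S' (f x)) ->
  (forall y, exists x, f x = y) ->
  (forall d x, gcomp d x -> gcomp d (f x)) ->
  (forall d y, gcomp d y -> exists2 x, gcomp d x & f x = y) ->
  galg_iso (galg_quot hS) (galg_quot hS').
Proof.
move=> fS f_surj f_gr f_lift.
have [|g gE] := @quot_lift k A (quot_alg hS') S hS (quot_proj hS' \o f).
  by move=> x Sx; apply/quot_proj_eq0/fS/gen_ideal_in.
have g_inj : injective g.
  move=> x y; rewrite -[x]quot_reprK -[y]quot_reprK !gE /=.
  by move=> /quot_projP eq_f; apply/quot_projP/fS; rewrite linearB.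
exists g; split.
  have g_surj y : exists x, g x == y.
    have [x def_y] := f_surj (quot_repr y); exists (quot_proj hS x).
    by rewrite gE /= def_y quot_reprK.
  exists (fun y => xchoose (g_surj y)) => [x|y].
    by apply: g_inj; apply/eqP/(xchooseP (g_surj (g x))).
  exact/eqP/(xchooseP (g_surj y)).
move=> d x; split=> [[x' dx' ->]|[y dy def_y]].
  by exists (f x'); [exact: f_gr | exact: gE].
have [x' dx' def_x'] := f_lift d y dy; exists x' => //.
by apply: g_inj; rewrite gE /= def_x'.
Qed.

Lemma eq_galg_quot (k : fieldType) (A : gradedAlg k) (S S' : A -> Prop)
    (hS : ~ gen_ideal S 1) (hS' : ~ gen_ideal S' 1) :
  (forall x, gen_ideal S x <-> gen_ideal S' x) ->
  galg_iso (galg_quot hS) (galg_quot hS').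
Proof.
move=> eqS; apply: (@galg_quot_iso k A A S S' hS hS' idfun) => //.
  by move=> y; exists y.
by move=> d y dy; exists y.
Qed.

(** * Quadratic tensors of the three classes *)

Section QuadTensors.
Variables (R : comNzRingType) (n : nat).
Implicit Types (c : quad_class) (M : 'M[R]_n).

(** Lifts of [quad_basis] to tensors: a commutative monomial is represented by its word x_j x_l with
    j <= l. *)
Definition quad_tens c : quad_index c n -> 'M[R]_n :=
  match c return quad_index c n -> 'M[R]_n with
  | Commutative => fun q => delta_mx (val q).1 (val q).2
  | NonCommutative => fun q => delta_mx q.1 q.2
  | LieType => fun q => if (val q).1 == (val q).2 then delta_mx (val q).1 (val
    q).2
      else delta_mx (val q).1 (val q).2 + delta_mx (val q).2 (val q).1
  end.

Arguments quad_tens : clear implicits.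

Definition qform c (a : quad_index c n -> R) : 'M[R]_n :=
  \sum_q a q *: quad_tens c q.

Arguments qform : clear implicits.

(* The coordinates of the class of a tensor modulo the commutators in the
   commutative class, of the tensor itself in the other classes. *)
Definition qcoord c : quad_index c n -> 'M[R]_n -> R :=
  match c return quad_index c n -> 'M[R]_n -> R with
  | Commutative => fun q M => if (val q).1 == (val q).2 then M (val q).1 (val
    q).2
      else M (val q).1 (val q).2 + M (val q).2 (val q).1
  | NonCommutative => fun q M => M q.1 q.2
  | LieType => fun q M => M (val q).1 (val q).2
  end.

Arguments qcoord : clear implicits.

(** In every characteristic the symmetric tensors are the span of the x_j^2 and the x_j x_l + x_l
    x_j, that is, the possible relations of Lie type. *)
Definition qsymm c M : Prop := if c is LieType then M^T = M else True.

Lemma qcoord_is_linear c (q : quad_index c n) : linear_for *%R (qcoord c q).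
Proof.
move=> b M N; case: c q => [] q /=; rewrite !mxE //.
by case: eqP => // _; rewrite mulrDr addrACA.
Qed.

HB.instance Definition _ c (q : quad_index c n) :=
  GRing.isLinear.Build R 'M[R]_n R _ (qcoord c q) (@qcoord_is_linear c q).

Lemma qsymm0 c : qsymm c 0.
Proof. by case: c => //=; rewrite trmx0. Qed.

Lemma qsymmD c M N : qsymm c M -> qsymm c N -> qsymm c (M + N).
Proof. by case: c => //= sM sN; rewrite linearD /= sM sN. Qed.

Lemma qsymmZ c b M : qsymm c M -> qsymm c (b *: M).
Proof. by case: c => //= sM; rewrite linearZ /= sM. Qed.

Lemma qsymm_tens c (q : quad_index c n) : qsymm c (quad_tens c q).
Proof.
case: c q => //= q; case: eqP => [eq_q|_]; first by rewrite trmx_delta eq_q.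
by rewrite linearD /= !trmx_delta addrC.
Qed.

Lemma qsymm_form c (a : quad_index c n -> R) : qsymm c (qform c a).
Proof.
apply: (big_ind (qsymm c)); [exact: qsymm0|exact: qsymmD|] => q _.
exact/qsymmZ/qsymm_tens.
Qed.

Lemma qcoord_tens c (q q0 : quad_index c n) : qcoord c q0 (quad_tens c q) = (q0
  == q)%:R.
Proof.
case: c q q0 => [[[j l] jl] [[a b] ab]|[j l] [a b]|[[j l] jl] [[a b] ab]];
  rewrite -?val_eqE /= ?xpair_eqE ?mxE //.
- case: eqP => [<-|ne_ab]; first by [].
  (* The transposed entry contributes only if a = l and b = j, which together with a <= b and j <= l
     forces a = b. *)
  rewrite [(b == j) && _]andbC; case: (boolP (_ && (b == j)));
    last by rewrite addr0.
  case/andP=> /eqP def_l /eqP def_j; case: ne_ab; apply/val_inj/eqP.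
  by rewrite eqn_leq ab /= [nat_of_ord b](congr1 val def_j) [nat_of_ord
    a](congr1 val def_l).
- case: eqP => [->|ne_jl]; rewrite !mxE //.
  case: (boolP ((a == l) && _)); last by rewrite addr0.
  case/andP=> /eqP def_l /eqP def_j; case: ne_jl; apply/val_inj/eqP.
  by rewrite eqn_leq jl /= -[nat_of_ord j](congr1 val def_j) -[nat_of_ord
    l](congr1 val def_l).
Qed.

Lemma qcoord_form c (a : quad_index c n -> R) q : qcoord c q (qform c a) = a q.
Proof.
rewrite linear_sum (bigD1 q) //= linearZ /= qcoord_tens eqxx mulr1 big1 ?addr0
  //.
by move=> q' ne_q; rewrite linearZ /= qcoord_tens eq_sym (negPf ne_q) mulr0.
Qed.

Definition commutator_tens c (p : 'I_n * 'I_n) : 'M[R]_n :=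
  if c is Commutative then delta_mx p.1 p.2 - delta_mx p.2 p.1 else 0.

Lemma qcoord_commutator c (q : quad_index c n) p : qcoord c q (commutator_tens c
  p) = 0.
Proof.
case: c q => q; rewrite ?linear0 //=; rewrite !mxE.
case: eqP => [->|_]; first by rewrite [X in _ - (nat_of_bool X)%:R]andbC subrr.
rewrite [X in _ + ((nat_of_bool X)%:R - _)]andbC
  [X in _ + (_ - (nat_of_bool X)%:R)]andbC.
by rewrite addrA subrK subrr.
Qed.

Lemma sum_mul_eq (T : finType) (f : T -> R) (t : T) :
  \sum_p f p * (t == p)%:R = f t.
Proof.
rewrite (bigD1 t) //= eqxx mulr1 big1 ?addr0 // => p;
  rewrite eq_sym => /negPf->.
by rewrite mulr0.
Qed.

(** In the commutative class an entry below the diagonal is moved to the transposed place at the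
    cost of a commutator; in the other classes the coordinates determine the tensor. *)
Lemma qform_coord c M : qsymm c M ->
  M = qform c (fun q => qcoord c q M)
      + \sum_(p : 'I_n * 'I_n) (if (p.1 < p.2)%N then - M p.2 p.1 else 0) *:
          commutator_tens c p.
Proof.
(* The Kronecker symbol selects at most one ordered pair; [g] extends [f] to all pairs, so that the
   value needs no proof of j <= l. *)
have sum_val (j l : 'I_n) (f : {p : 'I_n * 'I_n | (p.1 <= p.2)%N} -> R)
    (g : 'I_n -> 'I_n -> R) : (forall q, f q = g (val q).1 (val q).2) ->
    \sum_q f q * ((j, l) == val q)%:R = if (j <= l)%N then g j l else 0.
  move=> fg; case: ifP => [le_jl|nle_jl].
    rewrite -[RHS](fg (exist _ (j, l) le_jl)) -[RHS]sum_mul_eq.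
    by apply: eq_bigr => q _; rewrite -val_eqE.
  rewrite big1 // => -[[a b] /= le_ab] _.
  case: eqP => [[eq_j eq_l]|_]; last by rewrite mulr0.
  by rewrite eq_j eq_l le_ab in nle_jl.
move=> sM; apply/matrixP => j l; rewrite mxE !summxE.
case: c sM => /= sM.
- under eq_bigr => q _ do rewrite !mxE -xpair_eqE -surjective_pairing.
  rewrite (sum_val _ _ _ (fun a b =>
    if a == b then M a b else M a b + M b a)) //.
  under [X in _ + X]eq_bigr => p _ do
    rewrite !mxE mulrBr [(j == p.2) && _]andbC -!xpair_eqE
      -surjective_pairing.
  rewrite sumrB !sum_mul_eq /=.
  case: (ltngtP j l) => [||/val_inj <-].
  + by rewrite subr0 ; case: eqP => [->|]; rewrite ?ltnn // addrK.
  + by rewrite !add0r opprK.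
  + by rewrite eqxx subr0 addr0.
- rewrite [X in _ + X]big1 ?addr0 => [|p _]; last by rewrite scaler0 mxE.
  under eq_bigr => q _ do rewrite !mxE -xpair_eqE -surjective_pairing.
  by rewrite sum_mul_eq.
- rewrite [X in _ + X]big1 ?addr0 => [|p _]; last by rewrite scaler0 mxE.
  (* The entry and its transpose are summed separately; the second sum omits the diagonal, where the
     square x_j^2 must count once. *)
  have -> : \sum_(q : {p : 'I_n * 'I_n | (p.1 <= p.2)%N})
      (M (val q).1 (val q).2 *: quad_tens LieType q) j l
    = \sum_(q : {p : 'I_n * 'I_n | (p.1 <= p.2)%N}) M (val q).1 (val q).2 * ((j,
      l) == val q)%:R
      + \sum_(q : {p : 'I_n * 'I_n | (p.1 <= p.2)%N})
               (if (val q).1 == (val q).2 then 0 else M (val q).1 (val q).2)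
               * ((l, j) == val q)%:R.
    rewrite -big_split; apply: eq_bigr => -[[a b] le_ab] _ /=.
    rewrite mxE; case: eqP => [->|ne_ab]; rewrite !mxE ?mul0r ?addr0 //.
    by rewrite mulrDr [(j == b) && _]andbC -!xpair_eqE.
  rewrite (sum_val _ _ _ (fun a b => M a b)) //.
  rewrite (sum_val _ _ _ (fun a b => if a == b then 0 else M a b)) //.
  case: (ltngtP j l) => [lt_jl||/val_inj <-].
  + by rewrite addr0.
  + by rewrite add0r -{1}sM mxE; case: eqP => [->|]; rewrite ?ltnn.
  + by rewrite eqxx addr0.
Qed.


End QuadTensors.
Arguments quad_tens {R n} c q.
Arguments qform {R n} c a.
Arguments qcoord {R n} c q M.


Lemma map_quad_tens (R S : comNzRingType) (phi : {rmorphism R -> S}) n c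
    (q : quad_index c n) :
  map_mx phi (quad_tens c q) = quad_tens c q.
Proof.
case: c q => q /=; rewrite ?map_delta_mx //.
by case: ifP => _; rewrite ?map_mxD !map_delta_mx.
Qed.

Lemma map_qform (R S : comNzRingType) (phi : {rmorphism R -> S}) n c
    (a : quad_index c n -> R) :
  map_mx phi (qform c a) = qform c (fun q => phi (a q)).
Proof.
rewrite /qform (raddf_sum (map_mx phi)); apply: eq_bigr => q _.
by rewrite /= map_mxZ map_quad_tens.
Qed.

Lemma map_commutator_tens (R S : comNzRingType) (phi : {rmorphism R -> S}) n c
    (p : 'I_n * 'I_n) :
  map_mx phi (commutator_tens R c p) = commutator_tens S c p.
Proof. by case: c => /=; rewrite ?map_mx0 // map_mxB !map_delta_mx. Qed.

(** The commutators are listed for all pairs and are 0 outside the commutative class, so that one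
    index type serves the three classes. *)
Definition quad_fam (R : comNzRingType) (c : quad_class) (n s : nat)
    (C : 'I_s -> quad_index c n -> R) (x : 'I_s + 'I_n * 'I_n) : 'M[R]_n :=
  match x with
  | inl i => qform c (C i)
  | inr p => commutator_tens R c p
  end.

(** The full space U of quadratic relations, on which the annihilator depends. It contains the
    commutators in the commutative class, since [qcoord] vanishes on them. *)
Definition quad_rel (k : fieldType) (c : quad_class) (n s : nat)
    (C : 'I_s -> quad_index c n -> k) (M : 'M[k]_n) : Prop :=
  qsymm c M /\ exists a : 'I_s -> k, forall q,
    qcoord c q M = \sum_i a i * C i q.

Section QuadRel.
Variables (k : fieldType) (c : quad_class) (n s : nat).
Variable C : 'I_s -> quad_index c n -> k.

Lemma quad_rel0 : quad_rel C 0.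
Proof.
split=> [|]; first exact: qsymm0.
by exists (fun=> 0) => q; rewrite linear0 big1 // => i _; rewrite mul0r.
Qed.

Lemma quad_relD M N : quad_rel C M -> quad_rel C N -> quad_rel C (M + N).
Proof.
move=> [sM [a Ma]] [sN [b Nb]]; split; first exact: qsymmD.
exists (fun i => a i + b i) => q; rewrite linearD /= Ma Nb -big_split.
by apply: eq_bigr => i _; rewrite mulrDl.
Qed.

Lemma quad_relZ b M : quad_rel C M -> quad_rel C (b *: M).
Proof.
move=> [sM [a Ma]]; split; first exact: qsymmZ.
exists (fun i => b * a i) => q; rewrite linearZ /= Ma mulr_sumr.
by apply: eq_bigr => i _; rewrite mulrA.
Qed.

Lemma quad_rel_fam x : quad_rel C (quad_fam C x).
Proof.
case: x => [i|p] /=; split.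
- exact: qsymm_form.
- exists (fun j => (i == j)%:R) => q; rewrite qcoord_form.
  rewrite (bigD1 i) //= eqxx mul1r big1 ?addr0 // => j;
    rewrite eq_sym => /negPf->.
  by rewrite mul0r.
- by case: (c) => //=; rewrite trmx0.
- exists (fun=> 0) => q; rewrite qcoord_commutator big1 // => i _.
  by rewrite mul0r.
Qed.

Lemma quad_rel_span M : quad_rel C M -> lin_span (fun N =>
  exists x, N = quad_fam C x) M.
Proof.
move=> [sM [a Ma]]; rewrite [M](qform_coord sM).
have span_sum (I : finType) (f : I -> 'M[k]_n) :
    (forall i, lin_span (fun N => exists x, N = quad_fam C x) (f i)) ->
    lin_span (fun N => exists x, N = quad_fam C x) (\sum_i f i).
  by move=> Sf; elim/big_ind: _ => //; [exact: lin_span0 | exact: lin_spanD].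
apply: lin_spanD; last first.
  apply: span_sum => p; apply/lin_spanZ/lin_span_in; by exists (inr p).
have -> : qform c (fun q => qcoord c q M) = \sum_i a i *: qform c (C i).
  rewrite /qform; under eq_bigr => q _ do rewrite Ma scaler_suml.
  rewrite exchange_big; apply: eq_bigr => i _; rewrite scaler_sumr.
  by apply: eq_bigr => q _; rewrite scalerA.
apply: span_sum => i; apply/lin_spanZ/lin_span_in; by exists (inl i).
Qed.

Lemma quad_rel_iso : galg_iso (tensor_quot (quad_rel C)) (fam_alg (quad_fam C)).
Proof.
apply: eq_galg_quot => x; split; apply: gen_ideal_sub => {x} x [M].
  move=> /quad_rel_span SM ->; rewrite -/(tens M).
  elim: SM => {M} [M [y ->]||M N _ SM _ SN|b M _ SM].
  - by apply: gen_ideal_in; exists (quad_fam C y) => //; exists y.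
  - by rewrite linear0; apply: gen_ideal0.
  - by rewrite linearD; exact: (gen_idealD SM SN).
  - by rewrite linearZ; exact: (gen_idealZ _ SM).
move=> [y ->] ->; apply: gen_ideal_in; exists (quad_fam C y) => //.
exact: quad_rel_fam.
Qed.

End QuadRel.

(** * Quadratic algebras as quotients of the free algebra *)

Lemma wcoef_tens (k : fieldType) (n : nat) (M : 'M[k]_n) (w : seq 'I_n) :
  wcoef w (tens M) = if w is [:: j; l] then M j l else 0.
Proof.
have := wcoef_sandwich M [::] [::] w; rewrite word0 mul1r mulr1 => ->.
by rewrite /sandwich drop0 take0; case: w => [|j [|l [|m w]]].
Qed.

Lemma tens_delta (k : fieldType) (n : nat) (j l : 'I_n) :
  tens (delta_mx j l) = free_var k j * free_var k l.
Proof.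
apply: wcoefP => w; rewrite wcoef_tens -!word1 -word_cat wcoef_word.
case: w => [|a [|b [|d w]]]; rewrite //= !eqseq_cons ?andbF //.
by rewrite mxE andbT.
Qed.

Lemma tens_qform (k : fieldType) (n : nat) (c : quad_class)
    (a : quad_index c n -> k) :
  tens (qform c a) = \sum_q a q *: tens (quad_tens c q).
Proof. by rewrite linear_sum; apply: eq_bigr => q _; rewrite linearZ. Qed.

Lemma tens_commutator (k : fieldType) (n : nat) (p : 'I_n * 'I_n) :
  tens (commutator_tens k Commutative p)
  = free_var k p.1 * free_var k p.2 - free_var k p.2 * free_var k p.1.
Proof.
apply: etrans (linearB (@tens k n) _ _) _.
exact: (congr2 (fun u v => u - v) (tens_delta _ _ _) (tens_delta _ _ _)).
Qed.

Lemma tens_qform_noncommutative (k : fieldType) (n : nat)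
    (a : quad_index NonCommutative n -> k) :
  tens (qform NonCommutative a) = \sum_q a q *: quad_basis NonCommutative k n q.
Proof.
by rewrite tens_qform; apply: eq_bigr => q _; rewrite tens_delta.
Qed.

Lemma tens_qform_lie (k : fieldType) (n : nat) (a : quad_index LieType n -> k) :
  tens (qform LieType a) = \sum_q a q *: quad_basis LieType k n q.
Proof.
rewrite tens_qform; apply: eq_bigr => -[[j l] le_jl] _ /=.
by congr (_ *: _); case: ifP => [/eqP->|_]; rewrite ?linearD /= !tens_delta.
Qed.

(** * Passage from the free algebra to polynomials *)

Section Abelianization.
Variables (k : fieldType) (n : nat).

Definition abelianize : {lrmorphism free_alg k n -> {mpoly k[n]}} :=
  free_eval (fun i => 'X_i : {mpoly k[n]}).

Lemma abelianize_qform (a : quad_index Commutative n -> k) :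
  abelianize (tens (qform Commutative a)) = \sum_q a q *: quad_basis Commutative
    k n q.
Proof.
rewrite tens_qform linear_sum; apply: eq_bigr => q _;
  rewrite linearZ /= tens_delta.
by rewrite rmorphM /= !free_eval_var.
Qed.

Lemma abelianize_commutator (p : 'I_n * 'I_n) :
  abelianize (tens (commutator_tens k Commutative p)) = 0.
Proof.
have abM i j : abelianize (free_var k i * free_var k j) = 'X_i * 'X_j.
  by rewrite rmorphM /= !free_eval_var.
rewrite tens_commutator; apply: etrans (linearB abelianize _ _) _.
apply: etrans (congr2 (fun u v => u - v) (abM _ _) (abM _ _)) _.
by rewrite mulrC subrr.
Qed.

Lemma abelianize_word s : abelianize (word k s) = 'X_[(\sum_(i <- s) U_(i))%MM].
Proof. by rewrite /abelianize /= free_eval_word mprodXE. Qed.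

Lemma mdeg_word (s : seq 'I_n) : mdeg (\sum_(i <- s) U_(i))%MM = size s.
Proof.
by rewrite mdeg_sum; under eq_bigr do rewrite mdeg1; rewrite sum1_size.
Qed.

Lemma abelianize_gcomp d x :
  @gcomp k (free_galg k n) d x -> abelianize x \is d.-homog.
Proof.
elim/free_gcomp_ind => [|x' y dx dy|c s size_s].
- by rewrite linear0 dhomog0.
- by rewrite linearD; exact: (dhomogD dx dy).
rewrite linearZ; apply: dhomogZ; rewrite [X in X \in _]abelianize_word.
have : ('X_[(\sum_(i <- s) U_(i))%MM] : {mpoly k[n]})
    \is (mdeg (\sum_(i <- s) U_(i))%MM).-homog by rewrite dhomogX.
by rewrite mdeg_word size_s.
Qed.

Definition mword (m : 'X_{1..n}) : seq 'I_n :=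
  flatten [seq nseq (m i) i | i <- enum 'I_n].

Lemma mwordE (m : 'X_{1..n}) : (\sum_(i <- mword m) U_(i))%MM = m.
Proof.
rewrite big_flatten big_map big_enum /= [RHS]multinomUE_id;
  apply: eq_bigr => i _.
by rewrite big_nseq -Monoid.iteropE.
Qed.

(** A degree-preserving section of [abelianize]: each monomial is written with its variables in
    increasing order. *)
Definition mlift (p : {mpoly k[n]}) : free_alg k n :=
  \sum_(m <- msupp p) p@_m *: word k (mword m).

Lemma mliftK : cancel mlift abelianize.
Proof.
move=> p; rewrite linear_sum [RHS]mpolyE; apply: eq_bigr => m _.
rewrite linearZ; congr (_ *: _); apply: etrans (abelianize_word _) _.
by rewrite mwordE.
Qed.

Lemma mlift_gcomp d (p : {mpoly k[n]}) :
  p \is d.-homog -> @gcomp k (free_galg k n) d (mlift p).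
Proof.
move=> /dhomogP dp; apply/free_gcompP => s; apply: contraNeq => ne_sd.
rewrite wcoef_sum big_seq big1 // => m /dp /= dm; rewrite wcoefZ wcoef_word.
case: (s =P _) => [def_s|]; last by rewrite mulr0.
by case/eqP: ne_sd; rewrite def_s -mdeg_word mwordE.
Qed.

Variables (S : free_alg k n -> Prop) (hS : ~ gen_ideal S 1).
Hypothesis S_comm : forall p, gen_ideal S (tens (commutator_tens k Commutative
  p)).

Local Notation pr := (quot_proj hS : {lrmorphism free_alg k n -> quot_alg hS}).

Lemma quot_alg_comm (x y : quot_alg hS) : GRing.comm x y.
Proof.
have comm_gen i j : GRing.comm (pr (free_var k i)) (pr (free_var k j)).
  have := S_comm (i, j); rewrite tens_commutator => /(quot_projP hS) eq_ij.
  exact: etrans (esym (rmorphM pr _ _)) (etrans eq_ij (rmorphM pr _ _)).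
have comm_free (z : quot_alg hS) :
    (forall i, GRing.comm z (pr (free_var k i))) ->
      forall a, GRing.comm z (pr a).
  move=> comm_z; elim/free_alg_ind => [|a b comm_a comm_b|c s].
  - by rewrite linear0; apply: commr0.
  - rewrite (linearD pr a b); exact: (commrD comm_a comm_b).
  rewrite linearZ /=; suff comm_s : GRing.comm z (pr (word k s)).
    apply: etrans (esym (scalerAr _ _ _)) _.
    exact: (etrans (congr1 _ comm_s) (scalerAl _ _ _)).
  elim: s => [|i s IHs]; first by rewrite word0 rmorph1; apply: commr1.
  by rewrite word_cons (rmorphM pr); exact: (commrM (comm_z i) IHs).
rewrite -[x]quot_reprK -[y]quot_reprK.
apply/commr_sym/comm_free => i; apply/commr_sym/comm_free => j.
exact: comm_gen.
Qed.

(* Modulo the commutators the free algebra is commutative, so that polynomials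
   can be evaluated in the quotient. *)
Lemma abelianize_factor :
  exists g : {lrmorphism {mpoly k[n]} -> quot_alg hS},
    forall x, g (abelianize x) = quot_proj hS x.
Proof.
pose f := in_alg (quot_alg hS).
pose g (p : {mpoly k[n]}) : quot_alg hS := mmap f (fun i =>
  pr (free_var k i)) p.
have g_linear : linear g.
  by move=> c p q; rewrite /g raddfD /= mmapZ /f /= mulr_algl.
have g_mul : monoid_morphism g.
  have [gM g1] : multiplicative g; last by split.
  by apply: commr_mmap_is_multiplicative => *; apply: quot_alg_comm.
pose gL := GRing.isLinear.Build k {mpoly k[n]} (quot_alg hS) _ g g_linear.
pose gX := GRing.isMonoidMorphism.Build {mpoly k[n]} (quot_alg hS) g g_mul.
pose g' : {lrmorphism {mpoly k[n]} -> quot_alg hS} := HB.pack g gL gX.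
exists g' => x.
apply: (eq_free_lrmorphism (f := g' \o abelianize) (g := pr)) => i /=.
by rewrite /= free_eval_var /g mmapX mmap1U.
Qed.

End Abelianization.

Lemma lrmorphism_gen_ideal (R R' : nzRingType) (f : {rmorphism R -> R'})
    (S : R -> Prop) (S' : R' -> Prop) :
  (forall x, S x -> gen_ideal S' (f x)) ->
  forall x, gen_ideal S x -> gen_ideal S' (f x).
Proof.
move=> fS x; elim=> {x} [x /fS //||x y _ Sx _ Sy|a x _ Sx|a x _ Sx].
- by rewrite rmorph0; apply: gen_ideal0.
- by rewrite rmorphD; apply: gen_idealD.
- by rewrite rmorphM; apply: gen_idealMl.
- by rewrite rmorphM; apply: gen_idealMr.
Qed.

Lemma quad_alg_iso (k : fieldType) (c : quad_class) (n s : nat)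
    (C : 'I_s -> quad_index c n -> k) :
  galg_iso (fam_alg (quad_fam C)) (quad_alg C).
Proof.
case: c C => C.
- set S := fun x => exists2 M, (exists y, M = quad_fam C y) & x = tensor2 M.
  set S' := fun x => exists i, x = quad_form C i.
  have SC i : gen_ideal S (tens (qform Commutative (C i))).
    by apply: gen_ideal_in; exists (quad_fam C (inl i)) => //; exists (inl i).
  have Scomm p : gen_ideal S (tens (commutator_tens k Commutative p)).
    by apply: gen_ideal_in; exists (quad_fam C (inr p)) => //; exists (inr p).
  have hS : ~ gen_ideal S 1 := @tensor2_proper k n _.
  have [g gE] := abelianize_factor hS Scomm.
  apply: (@galg_quot_iso k (free_galg k n) (poly_galg k n) S S' _ _ (abelianize
    k n)).
  + move=> x; split.
      apply: lrmorphism_gen_ideal => {}x [_ [[i|p] ->] ->].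
        by apply: gen_ideal_in; exists i; apply: abelianize_qform.
      by rewrite [X in gen_ideal _ X]abelianize_commutator; apply: gen_ideal0.
    (* The kernel of abelianization is not computed: the projection onto the quotient factors as [g]
       after [abelianize], and [g] kills the commutative relations. *)
    move=> Sx; apply/(quot_proj_eq0 hS); rewrite -gE.
    apply: gen_ideal_ker Sx => _ [i ->].
    apply: etrans (congr1 g (esym (abelianize_qform _))) _.
    by apply: etrans (gE _) _; apply/quot_proj_eq0/SC.
  + by move=> p; exists (mlift p); apply: mliftK.
  + exact: abelianize_gcomp.
  + by move=> d p dp; exists (mlift p); [apply: mlift_gcomp | apply: mliftK].
- apply: (@eq_galg_quot k (free_galg k n)) => x.
  split; apply: gen_ideal_sub => {}x.
    move=> [_ [[i|p] ->] ->]; last by rewrite -/(tens _) linear0;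
      apply: gen_ideal0.
    by apply: gen_ideal_in; exists i; apply: tens_qform_noncommutative.
  move=> [i ->]; apply: gen_ideal_in; exists (quad_fam C (inl i));
    first by exists (inl i).
  exact/esym/tens_qform_noncommutative.
- apply: (@eq_galg_quot k (free_galg k n)) => x.
  split; apply: gen_ideal_sub => {}x.
    move=> [_ [[i|p] ->] ->]; last by rewrite -/(tens _) linear0;
      apply: gen_ideal0.
    by apply: gen_ideal_in; exists i; apply: tens_qform_lie.
  move=> [i ->]; apply: gen_ideal_in; exists (quad_fam C (inl i));
    first by exists (inl i).
  exact/esym/tens_qform_lie.
Qed.

(** * Linear substitutions *)

Definition subspace (k : fieldType) (V : lmodType k) (U : V -> Prop) : Prop :=
  [/\ U 0, forall M N, U M -> U N -> U (M + N) & forall c M, U M -> U (c *: M)].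

Lemma subspace_quad_rel (k : fieldType) (c : quad_class) (n s : nat)
    (C : 'I_s -> quad_index c n -> k) : subspace (quad_rel C).
Proof.
by split=> [|M N|b M]; [exact: quad_rel0 | exact: quad_relD | exact: quad_relZ].
Qed.

Definition tens_rel (k : fieldType) (n : nat) (U : 'M[k]_n -> Prop)
    (x : free_galg k n) : Prop := exists2 M, U M & x = tensor2 M.

Section LowDegree.
Variables (k : fieldType) (n : nat) (U : 'M[k]_n -> Prop).
Hypothesis subU : subspace U.

(** An ideal generated in degree 2 has nothing below degree 2, and only the generators in degree 2.
    The three claims go together: multiplication by a variable raises degrees by one, so the part of
    degree 2 of the product comes from a part of degree 1 that is 0. *)
Lemma tens_rel_low_degree (x : free_alg k n) : gen_ideal (tens_rel U) x ->
  [/\ wcoef [::] x = 0, forall j, wcoef [:: j] x = 0 &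
      U (\matrix_(j, l) wcoef [:: j; l] x)].
Proof.
have [U0 UD UZ] := subU.
pose P (x : free_alg k n) := [/\ wcoef [::] x = 0, forall j,
  wcoef [:: j] x = 0 &
      U (\matrix_(j, l) wcoef [:: j; l] x)].
have P0 : P 0.
  split=> [|j|]; rewrite ?wcoef0 //.
  suff -> : \matrix_(j, l) wcoef [:: j; l] (0 : free_alg k n) = 0 by [].
  by apply/matrixP => j l; rewrite !mxE wcoef0.
have PD (y z : free_alg k n) : P y -> P z -> P (y + z).
  move=> [y0 y1 y2] [z0 z1 z2]; split=> [|j|].
  - by rewrite wcoefD y0 z0 addr0.
  - by rewrite wcoefD y1 z1 addr0.
  suff -> : \matrix_(j, l) wcoef [:: j; l] (y + z)
    = \matrix_(j, l) wcoef [:: j; l] y + \matrix_(j, l) wcoef [:: j;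
      l] z by apply: UD.
  by apply/matrixP => j l; rewrite !mxE wcoefD.
have PZ b (y : free_alg k n) : P y -> P (b *: y).
  move=> [y0 y1 y2]; split=> [|j|].
  - by rewrite wcoefZ y0 mulr0.
  - by rewrite wcoefZ y1 mulr0.
  suff -> : \matrix_(j, l) wcoef [:: j; l] (b *: y)
    = b *: \matrix_(j, l) wcoef [:: j; l] y by apply: UZ.
  by apply/matrixP => j l; rewrite !mxE wcoefZ.
move=> Ux; suff : P x by [].
elim: Ux => {x} [x [M UM ->]||x y _ Px _ Py|a x _ Px|a x _ Px].
- rewrite -/(tens M); split=> [|j|]; rewrite ?wcoef_tens //.
  suff -> : \matrix_(j, l) wcoef [:: j; l] (tens M) = M by [].
  by apply/matrixP => j l; rewrite !mxE wcoef_tens.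
- exact: P0.
- exact: PD.
- apply: free_mul_closedl Px => // i y [y0 y1 y2]; split=> [|j|].
  + by rewrite wcoefMl.
  + by rewrite wcoefMl /= y0 if_same.
  suff -> : \matrix_(j, l) wcoef [:: j; l] (free_var k i * y) = 0 by [].
  by apply/matrixP => j l; rewrite !mxE wcoefMl /= y1 if_same.
- apply: free_mul_closedr Px => // i y [y0 y1 y2]; split=> [|j|].
  + by rewrite wcoefMr.
  + by rewrite wcoefMr /rev /= y0 if_same.
  suff -> : \matrix_(j, l) wcoef [:: j; l] (y * free_var k i) = 0 by [].
  by apply/matrixP => j l; rewrite !mxE wcoefMr /rev /= y1 if_same.
Qed.

Lemma tens_rel_tens M : gen_ideal (tens_rel U) (tens M) -> U M.
Proof.
case/tens_rel_low_degree => _ _; suff -> : \matrix_(j, l) wcoef [:: j;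
  l] (tens M) = M by [].
by apply/matrixP => j l; rewrite !mxE wcoef_tens.
Qed.

End LowDegree.

(** * Linear changes of variables and their action on tensors *)

Section Substitution.
Variable k : fieldType.

Definition lin_form n (u : 'rV[k]_n) : free_alg k n := \sum_j u 0 j *: free_var
  k j.

Lemma lin_form_is_linear n : linear (@lin_form n).
Proof.
move=> c u v; rewrite /lin_form scaler_sumr -big_split; apply: eq_bigr => j _.
by rewrite !mxE scalerDl scalerA.
Qed.

HB.instance Definition _ n :=
  GRing.isLinear.Build k 'rV[k]_n (free_alg k n) _ (@lin_form n)
    (@lin_form_is_linear n).

Lemma wcoef_lin_form n (u : 'rV[k]_n) j : wcoef [:: j] (lin_form u) = u 0 j.
Proof.
rewrite wcoef_sum; under eq_bigr => i _ do
  rewrite wcoefZ -word1 wcoef_word eqseq_cons andbT.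
by rewrite sum_mul_eq.
Qed.

Lemma lin_form_delta n (i : 'I_n) : lin_form (delta_mx 0 i) = free_var k i.
Proof.
apply: wcoefP => s; rewrite wcoef_sum -word1 wcoef_word.
under eq_bigr => j _ do rewrite wcoefZ -word1 wcoef_word mxE eqxx mulrC [_ ==
  i]eq_sym.
by rewrite sum_mul_eq.
Qed.

Lemma lin_formM n (u v : 'rV[k]_n) : lin_form u * lin_form v = tens (u^T *m v).
Proof.
rewrite tensE mulr_suml; apply: eq_bigr => j _.
rewrite mulr_sumr; apply: eq_bigr => l _.
rewrite mxE big_ord1 mxE -scalerA word_cons word1.
apply: etrans (esym (scalerAl _ _ _)) _; congr (_ *: _).
exact: esym (scalerAr _ _ _).
Qed.

Definition subst n n' (g : 'M[k]_(n, n')) : {lrmorphism free_alg k n ->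
  free_alg k n'} :=
  free_eval (fun i => lin_form (row i g)).

Lemma subst_var n n' (g : 'M[k]_(n, n')) i :
  subst g (free_var k i) = lin_form (row i g).
Proof. exact: free_eval_var. Qed.

Lemma subst_lin_form n n' (g : 'M[k]_(n, n')) u :
  subst g (lin_form u) = lin_form (u *m g).
Proof.
rewrite mulmx_sum_row !linear_sum; apply: eq_bigr => j _.
by rewrite !linearZ; congr (_ *: _); apply: subst_var.
Qed.

Lemma subst_tens n n' (g : 'M[k]_(n, n')) M :
  subst g (tens M) = tens (g^T *m M *m g).
Proof.
have -> : g^T *m M *m g = \sum_j \sum_l M j l *: ((row j g)^T *m row l g).
  apply/matrixP => a b; rewrite mxE.
  under eq_bigr => l _ do rewrite mxE mulr_suml.
  rewrite exchange_big summxE; apply: eq_bigr => j _; rewrite summxE.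
  by apply: eq_bigr => l _; rewrite !mxE big_ord1 !mxE mulrCA mulrA.
rewrite {1}/tens /tensor2 !linear_sum; apply: eq_bigr => j _.
rewrite !linear_sum; apply: eq_bigr => l _; rewrite !linearZ; congr (_ *: _).
apply: etrans (rmorphM (subst g) _ _) _.
apply: etrans (congr2 *%R (subst_var _ _) (subst_var _ _)) _.
exact: lin_formM.
Qed.

Lemma substK n n' (g : 'M[k]_(n, n')) (g' : 'M[k]_(n', n)) :
  g *m g' = 1%:M -> cancel (subst g) (subst g').
Proof.
move=> gg' x.
apply: (eq_free_lrmorphism (f := subst g' \o subst g) (g := idfun)) => i /=.
apply: etrans (congr1 _ (subst_var _ _)) _.
apply: etrans (subst_lin_form _ _) _.
by rewrite -row_mul gg' row1 lin_form_delta.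
Qed.

Lemma free_gcompD n d (x y : free_alg k n) :
  @gcomp k (free_galg k n) d x -> @gcomp k (free_galg k n) d y ->
  @gcomp k (free_galg k n) d (x + y).
Proof.
move=> /free_gcompP dx /free_gcompP dy; apply/free_gcompP => s; rewrite wcoefD.
by have [->|/dx] := eqVneq (wcoef s x) 0; rewrite ?add0r //; apply: dy.
Qed.

Lemma free_gcompZ n d c (x : free_alg k n) :
  @gcomp k (free_galg k n) d x -> @gcomp k (free_galg k n) d (c *: x).
Proof.
move=> /free_gcompP dx; apply/free_gcompP => s; rewrite wcoefZ.
by have [->|/dx] := eqVneq (wcoef s x) 0; rewrite ?mulr0 ?eqxx.
Qed.

Lemma free_gcomp0 n d : @gcomp k (free_galg k n) d (0 : free_alg k n).
Proof. by apply/free_gcompP => s; rewrite wcoef0 eqxx. Qed.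

Lemma free_gcompM n d e (x y : free_alg k n) :
  @gcomp k (free_galg k n) d x -> @gcomp k (free_galg k n) e y ->
  @gcomp k (free_galg k n) (d + e)%N (x * y).
Proof.
move=> dx ey; elim/free_gcomp_ind: x / dx => [|x x' dx dx'|c s <-].
- by rewrite mul0r; apply: free_gcomp0.
- by rewrite mulrDl; exact: (free_gcompD dx dx').
rewrite -scalerAl; apply: free_gcompZ.
elim/free_gcomp_ind: y / ey => [|y y' ey ey'|b t <-].
- by rewrite mulr0; apply: free_gcomp0.
- by rewrite mulrDr; exact: (free_gcompD ey ey').
rewrite -scalerAr; apply: free_gcompZ.
by rewrite -word_cat -size_cat; apply: free_gcomp_word.
Qed.

Lemma subst_gcomp n n' (g : 'M[k]_(n, n')) d x :
  @gcomp k (free_galg k n) d x -> @gcomp k (free_galg k n') d (subst g x).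
Proof.
elim/free_gcomp_ind => [|y z dy dz|c s <-].
- by rewrite linear0; apply: free_gcomp0.
- by rewrite linearD; exact: (free_gcompD dy dz).
rewrite linearZ; apply: free_gcompZ; elim: s => [|i s IHs] /=.
  by rewrite word0 rmorph1 -(word0 k n'); apply: free_gcomp_word.
rewrite word_cons (rmorphM (subst g)) -add1n; apply: free_gcompM IHs.
rewrite [X in gcomp _ X]subst_var /lin_form.
elim/big_ind: _ => [|y z dy dz|j _]; first exact: free_gcomp0.
  exact: (free_gcompD dy dz).
by apply: free_gcompZ; rewrite -word1; apply: free_gcomp_word.
Qed.

End Substitution.

(** * Koszul duals *)

(** The notion [annihilator] for a space given by a predicate, so that it applies to [quad_rel]. *)
Definition annih (k : fieldType) (n : nat) (U : 'M[k]_n ->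
  Prop) (N : 'M[k]_n) : Prop :=
  forall M, U M -> \sum_j \sum_l N j l * M j l = 0.

Lemma pairing_trace (k : fieldType) (n : nat) (N M : 'M[k]_n) :
  \sum_j \sum_l N j l * M j l = \tr (N *m M^T).
Proof.
by apply: eq_bigr => j _; rewrite mxE; apply: eq_bigr => l _; rewrite mxE.
Qed.

Lemma subst_iso (k : fieldType) (n n' : nat) (g : 'M[k]_(n,
  n')) (g' : 'M[k]_(n', n))
    (U : 'M[k]_n -> Prop) (U' : 'M[k]_n' -> Prop) :
  g *m g' = 1%:M -> g' *m g = 1%:M ->
  (forall M, U M -> U' (g^T *m M *m g)) ->
  (forall M, U' M -> U (g'^T *m M *m g')) ->
  galg_iso (tensor_quot U) (tensor_quot U').
Proof.
move=> gg' g'g UU' U'U.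
have gen_subst m m' (h : 'M[k]_(m, m')) (W : 'M[k]_m ->
  Prop) (W' : 'M[k]_m' -> Prop) :
    (forall M, W M -> W' (h^T *m M *m h)) ->
    forall x, gen_ideal (tens_rel W) x -> gen_ideal (tens_rel W') (subst h x).
  move=> WW' x; apply: lrmorphism_gen_ideal => _ [M WM ->].
  by apply: gen_ideal_in; exists (h^T *m M *m h);
    [exact: WW' | exact: subst_tens].
apply: (@galg_quot_iso k (free_galg k n) (free_galg k n') _ _ _ _ (subst g)).
- move=> x; split; first exact: gen_subst.
  by move=> /(gen_subst _ _ g' _ _ U'U); rewrite substK.
- by move=> y; exists (subst g' y); rewrite substK.
- by move=> d x; apply: subst_gcomp.
- move=> d y dy; exists (subst g' y); last by rewrite substK.
  exact: subst_gcomp.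
Qed.

(** The image of a variable has degree 1, hence is the class of a linear form, and a morphism from
    the free algebra is determined by the images of the variables. *)
Lemma graded_morphism_linear (k : fieldType) (n n' : nat) (U : 'M[k]_n -> Prop)
    (U' : 'M[k]_n' -> Prop) (f : {lrmorphism tensor_quot U -> tensor_quot U'}) :
  (forall d x, gcomp d x -> gcomp d (f x)) ->
  exists g : 'M[k]_(n, n'), forall x,
    f (quot_proj (tensor2_proper (U := U)) x)
    = quot_proj (tensor2_proper (U := U')) (subst g x).
Proof.
move=> f_gr; pose pr := quot_proj (tensor2_proper (U := U)).
pose pr' := quot_proj (tensor2_proper (U := U')).
have f_var i : exists u : 'rV[k]_n', f (pr (free_var k i)) = pr' (lin_form u).
  have var1 : @gcomp k (free_galg k n) 1 (free_var k i).
    by rewrite -word1; apply: free_gcomp_word.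
  have [|y dy def_y] := f_gr 1%N (pr (free_var k i));
    first by exists (free_var k i).
  exists (\row_j wcoef [:: j] y); rewrite def_y; congr (pr' _).
  rewrite [y](free_gcomp1 dy); apply: eq_bigr => j _; rewrite mxE.
  by rewrite -(free_gcomp1 dy).
have [u def_u] := fin_all_exists f_var.
exists (\matrix_i u i) => x.
apply: (eq_free_lrmorphism (f := f \o pr) (g := pr' \o subst _)) => i /=.
apply: etrans (def_u i) _; congr (pr' _).
by apply: esym; apply: etrans (subst_var _ _) _; rewrite rowK.
Qed.

Lemma graded_morphism_rel (k : fieldType) (n n' : nat) (U : 'M[k]_n -> Prop)
    (U' : 'M[k]_n' -> Prop) (f : {lrmorphism tensor_quot U -> tensor_quot U'})
    (g : 'M[k]_(n, n')) :
  subspace U' ->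
  (forall x, f (quot_proj (tensor2_proper (U := U)) x)
    = quot_proj (tensor2_proper (U := U')) (subst g x)) ->
  forall M, U M -> U' (g^T *m M *m g).
Proof.
move=> subU' fE M UM; apply: (tens_rel_tens subU').
rewrite -subst_tens; apply/(quot_proj_eq0 (tensor2_proper (U := U'))).
rewrite -fE; have -> : quot_proj (tensor2_proper (U := U)) (tens M) = 0.
  by apply/quot_proj_eq0/gen_ideal_in; exists M.
exact: linear0.
Qed.

(** There are no relations in degree 1, so two linear forms with the same class are equal and the
    matrices inherit f' o f = id. *)
Lemma graded_morphism_inv (k : fieldType) (n n' : nat) (U : 'M[k]_n -> Prop)
    (U' : 'M[k]_n' -> Prop) (f : {lrmorphism tensor_quot U -> tensor_quot U'})
    (f' : {lrmorphism tensor_quot U' -> tensor_quot U})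
    (g : 'M[k]_(n, n')) (g' : 'M[k]_(n', n)) :
  subspace U -> cancel f f' ->
  (forall x, f (quot_proj (tensor2_proper (U := U)) x)
    = quot_proj (tensor2_proper (U := U')) (subst g x)) ->
  (forall x, f' (quot_proj (tensor2_proper (U := U')) x)
    = quot_proj (tensor2_proper (U := U)) (subst g' x)) ->
  g *m g' = 1%:M.
Proof.
move=> subU fK fE f'E; apply/row_matrixP => i.
have := fK (quot_proj (tensor2_proper (U := U)) (lin_form (delta_mx 0 i))).
rewrite fE f'E !subst_lin_form => /quot_projP; rewrite -linearB.
case/(tens_rel_low_degree subU) => _ low1 _; apply/rowP => j.
apply/eqP; rewrite -subr_eq0 row1 rowE mulmxA; apply/eqP.
by have := low1 j; rewrite wcoef_lin_form !mxE.
Qed.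

(** The Koszul dual does not depend on the presentation. The isomorphism is a substitution [g] with
    inverse [g'] that exchanges [U] and [U']; cyclicity of the trace turns the pairing of g' N g'^T
    with M' into that of N with g'^T M' g', so [g'^T] exchanges the annihilators. *)
Lemma tensor_quot_dual_iso (k : fieldType) (n n' : nat) (U : 'M[k]_n -> Prop)
    (U' : 'M[k]_n' -> Prop) :
  subspace U -> subspace U' -> galg_iso (tensor_quot U) (tensor_quot U') ->
  galg_iso (tensor_quot (annih U)) (tensor_quot (annih U')).
Proof.
move=> subU subU' [f [[h fK hK] f_gr]].
have [f' eq_h] := lrmorphism_inv fK hK.
have f'_gr d x : gcomp d x -> gcomp d (f' x).
  by move=> dx; rewrite f_gr eq_h hK.
have f'K : cancel f f' by move=> x; rewrite eq_h fK.
have fK' : cancel f' f by move=> x; rewrite eq_h hK.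
have [|g gE] := @graded_morphism_linear _ _ _ _ _ f; first by move=> d x /f_gr.
have [g' g'E] := @graded_morphism_linear _ _ _ _ _ f' f'_gr.
have gg' := graded_morphism_inv subU f'K gE g'E.
have g'g := graded_morphism_inv subU' fK' g'E gE.
have UU' := graded_morphism_rel subU' gE.
have U'U := graded_morphism_rel subU g'E.
apply: (@subst_iso k n n' g'^T g^T).
- by rewrite -trmx_mul gg' trmx1.
- by rewrite -trmx_mul g'g trmx1.
- move=> N annN M' U'M'; rewrite pairing_trace trmxK -!mulmxA mxtrace_mulC
    -!mulmxA.
  by have := annN _ (U'U _ U'M'); rewrite pairing_trace !trmx_mul trmxK.
- move=> N annN M UM; rewrite pairing_trace trmxK -!mulmxA mxtrace_mulC
    -!mulmxA.
  by have := annN _ (UU' _ UM); rewrite pairing_trace !trmx_mul trmxK.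
Qed.

(** * Annihilators of relations within the three classes *)

Definition dual_class (c : quad_class) : quad_class :=
  match c with
  | Commutative => LieType
  | NonCommutative => NonCommutative
  | LieType => Commutative
  end.

(** The identity in each case; the two index types coincide only once [c] is known. *)
Definition dual_index (c : quad_class) (n : nat) :
    quad_index (dual_class c) n -> quad_index c n :=
  match c return quad_index (dual_class c) n -> quad_index c n with
  | Commutative => id | NonCommutative => id | LieType => id
  end.

Definition quad_orth (k : fieldType) (c : quad_class) (n s : nat)
    (C : 'I_s -> quad_index c n -> k) (N : 'M[k]_n) : Prop :=
  qsymm c N /\ forall i, \sum_q qcoord c q N * C i q = 0.

(** The coordinate of [N] at q in the dual class is its value on [quad_tens c q]: the coordinate
    systems of dual classes were chosen dual to each other. *)
Lemma pairing_qform (k : fieldType) (c : quad_class) (n : nat) (N : 'M[k]_n)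
    (a : quad_index c n -> k) : qsymm (dual_class c) N ->
  \sum_j \sum_l N j l * qform c a j l
  = \sum_q qcoord (dual_class c) q N * a (dual_index q).
Proof.
move=> sN.
have pair_sum (I : finType) (f : I -> 'M[k]_n) :
    \sum_j \sum_l N j l * (\sum_i f i) j l = \sum_i \sum_j \sum_l N j l * f i j
      l.
  rewrite [RHS]exchange_big; apply: eq_bigr => j _.
  rewrite [RHS]exchange_big; apply: eq_bigr => l _.
  by rewrite summxE mulr_sumr.
have pair_delta a0 b0 : \sum_j \sum_l N j l * (delta_mx a0 b0 : 'M[k]_n) j l = N
  a0 b0.
  rewrite -[RHS](sum_mul_eq (fun p : 'I_n * 'I_n =>
    N p.1 p.2) (a0, b0)) pair_bigA.
  by apply: eq_bigr => -[j l] _ /=;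
    rewrite mxE xpair_eqE ![_ == a0]eq_sym ![_ == b0]eq_sym.
have pair_tens b (T : 'M[k]_n) :
    \sum_j \sum_l N j l * (b *: T) j l = b * \sum_j \sum_l N j l * T j l.
  rewrite mulr_sumr; apply: eq_bigr => j _; rewrite mulr_sumr;
    apply: eq_bigr => l _.
  by rewrite mxE mulrCA.
have pair_add (T T' : 'M[k]_n) :
    \sum_j \sum_l N j l * (T + T') j l
    = \sum_j \sum_l N j l * T j l + \sum_j \sum_l N j l * T' j l.
  rewrite -big_split; apply: eq_bigr => j _; rewrite -big_split;
    apply: eq_bigr => l _.
  by rewrite mxE mulrDr.
rewrite pair_sum; case: c a sN => a /= sN; apply: eq_bigr => q _;
  rewrite pair_tens mulrC.
- by rewrite pair_delta.
- by rewrite pair_delta.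
- by congr (_ * _); case: ifP => _; rewrite ?pair_add !pair_delta.
Qed.

(** Annihilating the commutators means being symmetric, so a commutative algebra has a dual of Lie
    type. For Lie type no symmetry is imposed on [N]: its commutative coordinates already give its
    values on symmetric tensors. *)
Lemma annih_quad_rel (k : fieldType) (c : quad_class) (n s : nat)
    (C : 'I_s -> quad_index c n -> k) (N : 'M[k]_n) :
  annih (quad_rel C) N <-> quad_orth (c := dual_class c) (fun i q =>
    C i (dual_index q)) N.
Proof.
split=> [annN|[sN orthN] M /quad_rel_span SM].
  have sN : qsymm (dual_class c) N.
    case: c C annN => //= C annN; apply/matrixP => j l; rewrite mxE.
    have := annN _ (quad_rel_fam (c := Commutative) C (inr (l, j)));
      rewrite /= pairing_trace.
    rewrite linearB /= !trmx_delta mulmxBr linearB /= => /eqP;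
      rewrite subr_eq0 => /eqP.
    have tr_delta a b : \tr (N *m delta_mx a b) = N b a.
      rewrite mxtrace_mulC /mxtrace (bigD1 a) //= mxE (bigD1 b) //= !mxE !eqxx
        mul1r.
      rewrite big1 ?addr0 => [|i /negPf ne_ib];
        last by rewrite mxE ne_ib andbF mul0r.
      rewrite big1 ?addr0 // => i /negPf ne_ia; rewrite mxE big1 // => m _.
      by rewrite mxE ne_ia mul0r.
    by rewrite !tr_delta.
  split=> // i; rewrite -(pairing_qform (C i) sN).
  exact: annN (quad_rel_fam C (inl i)).
elim: SM => {M} [_ [[i|p] ->]||M M' _ IHM _ IHM'|b M _ IHM].
- by rewrite /= pairing_qform.
- case: c C sN orthN => C /= sN _; last 2 first.
  + by rewrite big1 // => j _; rewrite big1 // => l _; rewrite mxE mulr0.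
  + by rewrite big1 // => j _; rewrite big1 // => l _; rewrite mxE mulr0.
  (* Pairing with a symmetric [N] is invariant under transposition, so both terms of a commutator
     have the same value. *)
  rewrite pairing_trace linearB /= !trmx_delta mulmxBr linearB /=.
  rewrite -[in X in X - _]sN -[delta_mx p.2 p.1]trmxK -trmx_mul mxtrace_tr.
  by rewrite trmx_delta mxtrace_mulC subrr.
- by rewrite big1 // => j _; rewrite big1 // => l _; rewrite mxE mulr0.
- rewrite pairing_trace linearD /= mulmxDr linearD /= -!pairing_trace.
  by rewrite IHM IHM' addr0.
- by rewrite pairing_trace linearZ /= -scalemxAr linearZ /= -pairing_trace IHM
    mulr0.
Qed.

(** The number of variables and the space [U] that witness duality need not be those of [C]; they
    are compared through the two presentations of [B]. *)
Lemma koszul_dual_quad_orth (k : fieldType) (c : quad_class) (n s : nat)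
    (C : 'I_s -> quad_index c n -> k) (B D : gradedAlg k) :
  is_koszul_dual B D -> galg_iso B (quad_alg C) ->
  galg_iso D (tensor_quot (quad_orth (c := dual_class c) (fun i q =>
    C i (dual_index q)))).
Proof.
move=> [m [U [isoB isoD]]] isoC; apply: galg_iso_trans isoD _.
have subU : subspace (fun M => M \in U).
  split=> [|M N|b M]; first exact: mem0v.
    exact: memvD.
  exact: memvZ.
have isoU : galg_iso (tensor_quot (fun M =>
  M \in U)) (tensor_quot (quad_rel C)).
  apply: galg_iso_trans (galg_iso_sym isoB) _; apply: galg_iso_trans isoC _.
  apply: galg_iso_trans (galg_iso_sym (quad_alg_iso C)) _.
  exact/galg_iso_sym/quad_rel_iso.
apply: galg_iso_trans (tensor_quot_dual_iso subU (subspace_quad_rel C) isoU) _.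
apply: eq_galg_quot => x; split; apply: gen_ideal_sub => _ [N relN ->].
  by apply: gen_ideal_in; exists N => //; apply/annih_quad_rel.
by apply: gen_ideal_in; exists N => //; apply/annih_quad_rel.
Qed.

(** * Coefficient matrices *)

Section CoefficientMatrix.
Variables (c : quad_class) (n : nat).
Local Notation N := #|quad_index c n|.

Definition mx_coef (R : Type) (s : nat) (A : 'M[R]_(s, N)) (i : 'I_s)
    (q : quad_index c n) : R := A i (enum_rank q).

Definition coef_mx (R : Type) (s : nat) (C : 'I_s -> quad_index c n -> R) :
    'M[R]_(s, N) := \matrix_(i, b) C i (enum_val b).

Lemma coef_mxK (R : Type) (s : nat) (C : 'I_s -> quad_index c n -> R) i q :
  mx_coef (coef_mx C) i q = C i q.
Proof. by rewrite /mx_coef mxE enum_rankK. Qed.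

Definition rel_mx (R : comNzRingType) (s : nat) (A : 'M[R]_(s, N)) (d : nat) :=
  sandwich_mx (quad_fam (mx_coef A)) d.

Lemma map_rel_mx (R S : comNzRingType) (phi : {rmorphism R -> S}) (s : nat)
    (A : 'M[R]_(s, N)) (d : nat) :
  map_mx phi (rel_mx A d) = rel_mx (map_mx phi A) d.
Proof.
rewrite map_sandwich_mx; apply: eq_sandwich_mx; case=> [i|p] /=;
  last exact: map_commutator_tens.
rewrite map_qform /qform; apply: eq_bigr => q _; congr (_ *: _).
by rewrite /mx_coef mxE.
Qed.

Section Field.
Variable k : fieldType.

Definition coord_row (M : 'M[k]_n) : 'rV[k]_N := \row_b qcoord c (enum_val b) M.

Lemma quad_relP (s : nat) (A : 'M[k]_(s, N)) (M : 'M[k]_n) :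
  quad_rel (mx_coef A) M <-> qsymm c M /\ (coord_row M <= A)%MS.
Proof.
split=> -[sM]; last first.
  case/submxP => a def_M; split=> //; exists (fun i => a 0 i) => q.
  by have /rowP/(_ (enum_rank q)) := def_M; rewrite !mxE enum_rankK.
case=> a def_M; split=> //; apply/submxP; exists (\row_i a i).
apply/rowP => b; rewrite !mxE def_M; apply: eq_bigr => i _.
by rewrite mxE /mx_coef enum_valK.
Qed.

Lemma quad_orthP (s : nat) (A : 'M[k]_(s, N)) (M : 'M[k]_n) :
  quad_orth (mx_coef A) M <-> qsymm c M /\ coord_row M *m A^T = 0.
Proof.
have orthE i : (coord_row M *m A^T) 0 i = \sum_q qcoord c q M * mx_coef A i q.
  rewrite mxE (reindex _ (onW_bij _ (@enum_rank_bij _))) /=.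
  by apply: eq_bigr => q _; rewrite !mxE enum_rankK.
split=> -[sM MA]; split=> //; last by move=> i; rewrite -orthE MA mxE.
by apply/rowP => i; rewrite orthE MA mxE.
Qed.

(** The row space of [rel_mx] is the part of degree d of the ideal, which grows with the space of
    relations. *)
Lemma rel_mx_mono (s t : nat) (A : 'M[k]_(s, N)) (B : 'M[k]_(t, N)) (d : nat) :
  (A <= B)%MS -> (\rank (rel_mx A d) <= \rank (rel_mx B d))%N.
Proof.
move=> sAB; apply/mxrankS/rV_subP => v /fam_idealP Av; apply/fam_idealP.
apply: gen_ideal_sub Av => _ [x ->].
have /quad_rel_span : quad_rel (mx_coef B) (quad_fam (mx_coef A) x).
  by have /quad_relP[sM /submx_trans/(_ sAB) MB] := quad_rel_fam (mx_coef A) x;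
    apply/quad_relP.
elim=> [M [y ->]||M M' _ IHM _ IHM'|b M _ IHM].
- by apply: gen_ideal_in; exists y.
- by rewrite linear0; apply: gen_ideal0.
- by rewrite linearD; exact: (gen_idealD IHM IHM').
- by rewrite linearZ; exact: (gen_idealZ _ IHM).
Qed.

Lemma hilbert_quad_alg (s : nat) (A : 'M[k]_(s, N)) :
  hilbert_series (quad_alg (mx_coef A))
    (fun d => (#|{: d.-tuple 'I_n}| - \rank (rel_mx A d))%N).
Proof. exact: hilbert_series_iso (quad_alg_iso _) (hilbert_fam_alg _). Qed.

Lemma quad_form_comb (s : nat) (C : 'I_s -> quad_index c n -> k) (a : 'I_s ->
  k) :
  \sum_i a i *: quad_form C i
  = \sum_q (\sum_i a i * C i q) *: quad_basis c k n q.
Proof.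
under eq_bigr => i _ do rewrite scaler_sumr.
rewrite exchange_big; apply: eq_bigr => q _; rewrite scaler_suml.
by apply: eq_bigr => i _; rewrite scalerA.
Qed.

Lemma lin_indep_row_free (s : nat) (C : 'I_s -> quad_index c n -> k) :
  lin_indep (quad_form C) -> row_free (coef_mx C).
Proof.
move=> freeC; apply: inj_row_free => v vC; apply/rowP => i; rewrite mxE.
apply: (freeC (fun i => v 0 i)); rewrite quad_form_comb big1 // => q _.
have /rowP/(_ (enum_rank q)) := vC; rewrite !mxE => vCq.
rewrite (_ : \sum_i _ = 0) ?scale0r // -[RHS]vCq; apply: eq_bigr => j _.
by rewrite mxE enum_rankK.
Qed.

End Field.
End CoefficientMatrix.

Lemma quad_basis_free (k : fieldType) (c : quad_class) (n : nat)
    (a : quad_index c n -> k) :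
  \sum_q a q *: quad_basis c k n q = 0 -> forall q, a q = 0.
Proof.
have tens_free (b : quad_index c n -> k) : tens (qform c b) = 0 ->
  forall q, b q = 0.
  move=> b0 q; rewrite -(qcoord_form b q).
  suff -> : qform c b = 0 by rewrite linear0.
  apply/matrixP => j l; have := wcoef_tens (qform c b) [:: j; l].
  by rewrite b0 wcoef0 mxE.
case: c a tens_free => a tens_free.
- rewrite -abelianize_qform => a0 q.
  (* With an empty family, [quad_rel C] is the span of the commutators, on which all coordinates
     vanish. *)
  pose C (i : 'I_0) (q : quad_index Commutative n) : k := 0.
  have [|g gE] := @abelianize_factor k n _ (@tensor2_proper k n (quad_rel C)).
    move=> p; apply: gen_ideal_in; exists (quad_fam C (inr p)) => //.
    exact: quad_rel_fam.
  have : gen_ideal (tens_rel (quad_rel C)) (tens (qform Commutative a)).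
    apply/(quot_proj_eq0 (tensor2_proper (U := quad_rel C))).
    by rewrite -gE; apply: etrans (congr1 g a0) _; apply: linear0.
  case/(tens_rel_tens (subspace_quad_rel C)) => _ [b /(_ q)].
  by rewrite qcoord_form big_ord0.
- by rewrite -tens_qform_noncommutative; apply: tens_free.
- by rewrite -tens_qform_lie; apply: tens_free.
Qed.

Lemma row_free_lin_indep (k : fieldType) (c : quad_class) (n s : nat)
    (A : 'M[k]_(s, #|quad_index c n|)) :
  row_free A -> lin_indep (quad_form (mx_coef A)).
Proof.
move=> freeA a; rewrite quad_form_comb => /quad_basis_free a0 i.
have : (\row_j a j) *m A = 0.
  apply/rowP => b; rewrite !mxE -[RHS](a0 (enum_val b)); apply: eq_bigr => j _.
  by rewrite mxE /mx_coef enum_valK.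
by move=> /eqP; rewrite mulmx_free_eq0 // => /eqP/rowP/(_ i); rewrite !mxE.
Qed.

(** * The generic rank *)

Section Specialization.
Variables (k0 K : fieldType) (iota : {rmorphism k0 ->
  K}) (I : finType) (a : I -> K).

Definition specialize : {rmorphism {mpoly k0[#|I|]} -> K} :=
  mmap iota (fun j => a (enum_val j)).

Lemma specialize_var i : specialize 'X_(enum_rank i) = a i.
Proof. by rewrite /specialize /= mmapX mmap1U enum_rankK. Qed.

Lemma specialize_inj : alg_indep iota a -> injective specialize.
Proof.
move=> indep p q /eqP; rewrite -subr_eq0 -rmorphB => /eqP/indep/eqP.
by rewrite subr_eq0 => /eqP.
Qed.

End Specialization.

Section GenericMatrix.
Variables (k0 : fieldType) (c : quad_class) (n s : nat).
Local Notation N := #|quad_index c n|.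
Local Notation I := ('I_s * quad_index c n)%type.

Definition generic_mx : 'M[{mpoly k0[#|{: I}|]}]_(s, N) :=
  coef_mx (fun i q => 'X_(enum_rank (i, q))).

Lemma map_generic_mx (K : fieldType) (iota : {rmorphism k0 ->
  K}) (A : 'M[K]_(s, N)) :
  map_mx (specialize iota (fun x : I => mx_coef A x.1 x.2)) generic_mx = A.
Proof.
by apply/matrixP => i b; rewrite !mxE specialize_var /mx_coef enum_valK.
Qed.

End GenericMatrix.

Definition coeff_frac (c : quad_class) (k0 : fieldType) (n r : nat) :
    {rmorphism {mpoly k0[#|{: 'I_r * quad_index c n}|]} ->
      coeff_field c k0 n r} :=
  @tofrac {mpoly k0[#|{: 'I_r * quad_index c n}|]}.

Lemma coeff_frac_inj (c : quad_class) (k0 : fieldType) (n r : nat) :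
  injective (coeff_frac c k0 n r).
Proof. by move=> p q /eqP; rewrite tofrac_eq => /eqP. Qed.

Lemma generic_quad_orth (k0 k : fieldType) (iota : {rmorphism k0 -> k})
    (c : quad_class) (n r : nat) (C : 'M[k]_(r, #|quad_index c n|))
    (D : gradedAlg k) :
  row_free C ->
  alg_indep iota (fun x : 'I_r * quad_index c n => mx_coef C x.1 x.2) ->
  galg_iso D (tensor_quot (quad_orth (mx_coef C))) ->
  generic c k0 D.
Proof.
move=> freeC indepC isoD; set N := #|_| in C freeC indepC isoD *.
have le_rN : (r <= N)%N by rewrite -(eqP freeC) rank_leq_col.
pose m := (N - r)%N.
have [|C' freeC' defC'] := @row_free_base k N N m (kermx C^T).
  by rewrite mxrank_ker mxrank_tr (eqP freeC).
have isoC' : galg_iso D (quad_alg (mx_coef C')).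
  apply: galg_iso_trans isoD _; apply: galg_iso_trans (quad_alg_iso _).
  apply: galg_iso_trans (quad_rel_iso _).
  apply: eq_galg_quot => x.
  have eq_rel M : quad_orth (mx_coef C) M <-> quad_rel (mx_coef C') M.
    rewrite quad_orthP quad_relP defC'.
    by split=> -[sM /sub_kermxP MC]; split.
  split; apply: gen_ideal_sub => _ [M relM ->]; apply: gen_ideal_in.
    by exists M => //; apply/eq_rel.
  by exists M => //; apply/eq_rel.
exists n, m; split.
  by exists (mx_coef C'); split=> //; apply: row_free_lin_indep.
pose F2 := coeff_field c k0 n m.
pose frac := coeff_frac c k0 n m.
pose X := generic_mx k0 c n r; pose Y := generic_mx k0 c n m.
pose G : 'M[F2]_(m, N) := map_mx frac Y.
(* Stated for any construction [f] compatible with ring morphisms, as it serves twice: for the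
   matrix itself, to see that [G] has full rank, and for [rel_mx]. *)
have le_C'G (p q : nat)
    (f : forall R : comNzRingType, 'M[R]_(m, N) -> 'M[R]_(p, q)) :
    (forall (R S : comNzRingType) (phi : {rmorphism R -> S}) A,
      map_mx phi (f R A) = f S (map_mx phi A)) ->
    (\rank (f k C') <= \rank (f F2 G))%N.
  move=> map_f; rewrite -[C'](map_generic_mx iota) -!map_f.
  exact/mxrank_specialize/coeff_frac_inj.
have freeG : row_free G.
  rewrite /row_free eqn_leq rank_leq_row /= -{1}(eqP freeC').
  exact: (le_C'G _ _ (fun R A => A)).
(* The orthogonal of [G] has dimension N - m = r, so [E] has the shape of [C] and both are
   specializations of [X]. *)
have [|E freeE defE] := @row_free_base F2 N N r (kermx G^T).
  by rewrite mxrank_ker mxrank_tr (eqP freeG) subKn.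
have GE : G *m E^T = 0.
  apply: trmx_inj; rewrite trmx_mul trmxK trmx0; apply/sub_kermxP.
  by rewrite defE.
(* The selection of columns is adapted to [E], where the generators must fill the whole
   orthogonal. *)
have [f unitE] := rowsub1_unit freeE.
exists (fun d => (#|{: d.-tuple 'I_n}| - \rank (rel_mx C' d))%N).
split; first exact: hilbert_series_iso (galg_iso_sym isoC') (hilbert_quad_alg
  _).
suff eq_rank d : \rank (rel_mx C' d) = \rank (rel_mx G d).
  move=> d; rewrite eq_rank; have := hilbert_quad_alg G d.
  rewrite (_ : mx_coef G = @indeterminate c k0 n m) //.
  apply: funext => i; apply: funext => q.
  by rewrite /mx_coef !mxE enum_rankK.
apply/eqP; rewrite eqn_leq; apply/andP; split.
  apply: (le_C'G _ _ (fun R A => rel_mx A d)) => R S phi A; exact: map_rel_mx.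
pose Z (R : comNzRingType) : 'M[R]_(r, N) := rowsub f 1%:M.
have mapZ (R S : comNzRingType) (phi : {rmorphism R ->
  S}) : map_mx phi (Z R) = Z S.
  by rewrite map_mxsub map_mx1.
have map_orth (K : fieldType) (phi : {rmorphism _ -> K}) :
    map_mx phi (rel_mx (orthgen_mx (Z _) X) d) = rel_mx (orthgen_mx (Z K)
      (map_mx phi X)) d.
  by rewrite map_rel_mx map_orthgen_mx mapZ.
apply: leq_trans (rel_mx_mono d (orthgen_mx_full unitE GE)) _.
pose iota2 : {rmorphism k0 -> F2} := frac \o @mpolyC _ k0.
rewrite -/(Z F2) -[E](map_generic_mx iota2) -map_orth.
(* Independence makes the specialization of [X] at [C] injective, so the rank at [E] is bounded by
   the rank at [C]. *)
apply: leq_trans (mxrank_specialize _ _ (specialize_inj indepC)) _.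
(* At [C] it is enough that the rows lie in the orthogonal, a polynomial identity valid whatever the
   determinant. *)
rewrite map_orth map_generic_mx; apply: rel_mx_mono.
by rewrite defC'; apply/sub_kermxP/orthgen_mxK.
Qed.

Lemma koszul_dual_generic (k0 k : fieldType) (iota : {rmorphism k0 -> k})
    (c : quad_class) (B D : gradedAlg k) :
  is_koszul_dual B D -> strictly_generic c iota B ->
    generic (dual_class c) k0 D.
Proof.
move=> dualBD [n [r [C [freeC isoB indepC]]]].
have isoD := koszul_dual_quad_orth dualBD isoB.
pose C' : 'I_r -> quad_index (dual_class c) n -> k := fun i q =>
  C i (dual_index q).
have freeC' : row_free (coef_mx C').
  by rewrite /C'; case: c C freeC {isoB isoD indepC C'} =>
    C /lin_indep_row_free.
have indepC' : alg_indep iota (fun x : 'I_r * _ => C' x.1 x.2).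
  by rewrite /C'; case: c C indepC {isoB isoD freeC C' freeC'}.
have eqC' : mx_coef (coef_mx C') = C'.
  by apply: funext => i; apply: funext => q; rewrite coef_mxK.
by apply: (generic_quad_orth (C := coef_mx C') (iota := iota)); rewrite ?eqC'.
Qed.

Theorem theorem4p1 (k0 k : fieldType) (iota : {rmorphism k0 -> k})
    (k0_prime : prime_field k0) (B D : gradedAlg k)
    (dual_BD : is_koszul_dual B D) :
  (strictly_generic Commutative iota B -> generic LieType k0 D) /\
  (strictly_generic NonCommutative iota B -> generic NonCommutative k0 D) /\
  (strictly_generic LieType iota B -> generic Commutative k0 D).
Proof.
split; first exact: (koszul_dual_generic (c := Commutative)).
by split; [exact: (koszul_dual_generic (c := NonCommutative))
         | exact: (koszul_dual_generic (c := LieType))].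
Qed.
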